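(* Let $d\ge2$, let $U\sim\mathcal{N}(0,\frac1d\mathrm{Id})$ in $\mathbb{R}^d$, and for $0<r_-<r_+<+\infty$ define the random vector $V\in\mathbb{R}^d$ by $$\frac{V}{|V|}=\frac{U}{|U|}\ \text{ a.s.},\qquad |V|=|U|\,\mathbf{1}_{|U|\notin[r_-,r_+]}+\mathbb{E}\big(|U|^2\,\big|\,|U|\in[r_-,r_+]\big)^{1/2}\,\mathbf{1}_{|U|\in[r_-,r_+]}.$$ Let $(U_\ast,V_\ast)$ be an i.i.d. copy of $(U,V)$. Then $$\lim_{r_-\to+\infty}\ \lim_{r_+\downarrow r_-}\ \frac{f\big(\mathbb{E}|V-U|^2\big)}{\mathbb{E}\big(|U-U_\ast||V-V_\ast|-(U-U_\ast)\cdot(V-V_\ast)\big)}=+\infty.$$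
   Context: $f(x)=x-\frac{x^2}{4}$ for $x\in[0,4]$. *)

(* Defs.v *)
From HB Require Import structures.
From mathcomp Require Import all_boot all_order all_algebra.
From mathcomp Require Import all_classical all_reals all_analysis.

Set Implicit Arguments.
Unset Strict Implicit.
Unset Printing Implicit Defensive.

Import Order.TTheory GRing.Theory Num.Theory.
Import numFieldNormedType.Exports.

Local Open Scope classical_set_scope.
Local Open Scope ring_scope.

(* Random vectors of R^d are random variables with values in [d.-tuple R],
   which carries the product sigma-algebra; [vec] moves such a value to
   ['rV[R]_d], where the linear operations live. *)
Definition vec (R : realType) (d : nat) (x : d.-tuple R) : 'rV[R]_d :=
  \row_(i < d) tnth x i.

Definition dotp (R : realType) (d : nat) (x y : 'rV[R]_d) : R :=
  \sum_(i < d) x ord0 i * y ord0 i.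

(* The norm `|x| of the library on ['rV[R]_d] is the sup norm. *)
Definition enorm (R : realType) (d : nat) (x : 'rV[R]_d) : R :=
  Num.sqrt (dotp x x).

(* Only used on the interval [0, 4], which contains E|V - U|^2. *)
Definition f (R : realType) (x : R) : R := x - x ^+ 2 / 4.

(* U ~ N(0, s^2 Id): the law of U is the d-fold product of N(0, s^2).
   The second parameter of [normal_prob] is the standard deviation. *)
Definition isotropic_gaussian (R : realType) (d : nat) (disp : measure_display)
    (T : measurableType disp) (P : probability T R) (s : R)
    (U : {RV P >-> d.-tuple R}) : Prop :=
  forall B : 'I_d -> set R, (forall i, measurable (B i)) ->
    P [set w | forall i, B i (tnth (U w) i)] =
    (\prod_(i < d) normal_prob 0 s (B i))%E.

(* E(X | A), conditioning on an event of positive probability *)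
Definition cond_expectation (R : realType) (disp : measure_display)
    (T : measurableType disp) (P : probability T R) (X : T -> R) (A : set T)
    : R :=
  fine ('E_P[fun w => X w * \1_A w]) / fine (P A).

Definition shell (R : realType) (d : nat) (T : Type) (U : T -> d.-tuple R)
    (rm rp : R) : set T :=
  [set w | rm <= enorm (vec (U w)) <= rp].

Definition shell_radius (R : realType) (d : nat) (disp : measure_display)
    (T : measurableType disp) (P : probability T R)
    (U : {RV P >-> d.-tuple R}) (rm rp : R) : R :=
  Num.sqrt
    (cond_expectation P (fun w => enorm (vec (U w)) ^+ 2) (shell U rm rp)).

(* The value 0 given to V/|V| at V = 0 is irrelevant: V <> 0 a.s. *)
Definition shell_collapse (R : realType) (d : nat) (disp : measure_display)
    (T : measurableType disp) (P : probability T R)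
    (U V : {RV P >-> d.-tuple R}) (rm rp : R) : Prop :=
  {ae P, forall w, (enorm (vec (V w)))^-1 *: vec (V w) =
                   (enorm (vec (U w)))^-1 *: vec (U w)} /\
  {ae P, forall w, enorm (vec (V w)) =
     enorm (vec (U w)) * \1_(~` shell U rm rp) w +
     shell_radius U rm rp * \1_(shell U rm rp) w}.

Definition iid_copy (R : realType) (disp disp' : measure_display)
    (T : measurableType disp) (T' : measurableType disp')
    (P : probability T R) (X Y : T -> T') : Prop :=
  (forall A, measurable A -> P (Y @^-1` A) = P (X @^-1` A)) /\
  (forall A B, measurable A -> measurable B ->
    P (X @^-1` A `&` Y @^-1` B) = (P (X @^-1` A) * P (Y @^-1` B))%E).

Definition cost_ratio (R : realType) (d : nat) (disp : measure_display)
    (T : measurableType disp) (P : probability T R)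
    (U V Us Vs : {RV P >-> d.-tuple R}) : R :=
  f (fine 'E_P[fun w => enorm (vec (V w) - vec (U w)) ^+ 2]) /
  fine 'E_P[fun w =>
    enorm (vec (U w) - vec (Us w)) * enorm (vec (V w) - vec (Vs w)) -
    dotp (vec (U w) - vec (Us w)) (vec (V w) - vec (Vs w))].

(* Main.v *)
Require Import Defs.
From HB Require Import structures.
From mathcomp Require Import all_boot all_order all_algebra.
From mathcomp Require Import all_classical all_reals all_analysis.
From mathcomp Require Import measurable_realfun.
From mathcomp Require Import ring lra.

Set Implicit Arguments.
Unset Strict Implicit.
Unset Printing Implicit Defensive.

Import Order.TTheory GRing.Theory Num.Theory.
Import numFieldNormedType.Exports.

Local Open Scope classical_set_scope.
Local Open Scope ring_scope.

(** Let mu be the law of U, and write r, r' for r_-, r_+ and rb for the radius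
    to which the shell r <= |x| <= r' is collapsed.  Almost surely V is
    obtained from U by a deterministic map, [collapse], which moves a point x
    of the shell by [radial_gap] x = rb - |x| along its direction x/|x| and
    fixes the other points.  Hence E|V - U|^2 is the mean delta of the squared
    gap ([mean_gap2]), and delta is at most (r' - r)^2.

    The integrand of the denominator is |a||b| - a.b with a = U - U_* and
    b = V - V_*.  It equals (|b - a|^2 - (|b| - |a|)^2)/2.  When only U is in
    the shell, b - a is the gap t times the direction th of U, and |b| - |a|
    is t times a difference quotient of the norm in the direction th; as the
    shell shrinks, this quotient tends to the cosine of the angle between th
    and r th - U_*.  The integrand is therefore t^2 sin^2 / 2 up to an error
    that is small compared with t^2, unless U_* is itself close to the sphere
    of radius r, and in all cases it is bounded by the sum of the two squared
    gaps ([pair_cost_le]); [pair_cost_bound] combines the two.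

    Under mu the gap depends on |U| only, and the sine on the direction of U
    and on U_*.  Since the radius and the direction of an isotropic Gaussian
    vector are independent ([radial_angular_indep]), the mean of t^2 sin^2 is
    exactly delta times sigma(r), the mean of sin^2 ([mean_gap2_sin2]).  The
    two cases, U in the shell and U_* in the shell, contribute equally, so the
    denominator is delta (sigma(r) + o(1)) ([mean_cost_bound]).  As
    f(delta) = delta (1 - delta/4), the inner limit is 1/sigma(r)
    ([mean_cost_ratio_cvg]).  Finally sigma(r) > 0 because two independent
    copies of U are not parallel with positive probability
    ([mean_sin2_gt0]), and sigma(r) tends to 0 as r grows, because r th - U_*
    is then nearly parallel to th ([mean_sin2_small]).

    Independence of radius and direction is proved by scaling.  Multiplying mu
    by exp(|u|^2 / 2 s^2) gives a multiple of Lebesgue measure, which the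
    dilation by t multiplies by t^n ([flat_scale]).  For a function g of the
    direction, the g-weighted mass of the ball of radius t is then t^n times
    that of the unit ball, so the radial laws attached to different functions g
    are proportional. *)

(** * Image measures and measures with a density *)

Definition density_measure (d : measure_display) (X : measurableType d)
    (R : realType) (m : {measure set X -> \bar R}) (h : X -> R)
    (mh : measurable_fun setT h) (h0 : forall x, 0 <= h x) : set X -> \bar R :=
  fun A => (\int[m]_(x in A) (h x)%:E)%E.

Section density_is_measure.
Local Open Scope ereal_scope.
Context d (X : measurableType d) (R : realType) (m : {measure set X -> \bar R})
  (h : X -> R) (mh : measurable_fun setT h) (h0 : forall x, (0 <= h x)%R).

Let dens0 : density_measure m mh h0 set0 = 0.
Proof. by rewrite /density_measure integral_set0. Qed.

Let dens_ge0 A : 0 <= density_measure m mh h0 A.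
Proof. by apply: integral_ge0 => x _; rewrite lee_fin. Qed.

Let dens_sigma : semi_sigma_additive (density_measure m mh h0).
Proof.
move=> F mF tF mUF; rewrite /density_measure ge0_integral_bigcup//=; last 2 first.
- by apply/measurable_EFinP; exact: measurable_funTS.
- by move=> x _; rewrite lee_fin.
by apply: is_cvg_ereal_nneg_natsum_cond => n _ _; exact: dens_ge0.
Qed.

HB.instance Definition _ := isMeasure.Build _ _ _ (density_measure m mh h0)
  dens0 dens_ge0 dens_sigma.

Import HBNNSimple.

(** True for indicators by definition, hence for simple functions, hence for
    nonnegative measurable functions by monotone convergence on both sides. *)
Lemma ge0_integral_density (f : X -> \bar R) :
  measurable_fun setT f -> (forall x, 0 <= f x) ->
  \int[density_measure m mh h0]_x f x = \int[m]_x (f x * (h x)%:E).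
Proof.
move=> mf f0.
pose f_ := nnsfun_approx measurableT mf.
have nd x : {homo (fun n => (f_ n x)%:E) : a b / (a <= b)%N >-> a <= b}.
  by move=> a b ab; rewrite lee_fin; exact/lefP/nd_nnsfun_approx.
have fE x : (f_ n x)%:E @[n --> \oo] --> f x.
  by apply: cvg_nnsfun_approx => // y _.
have mfn n : measurable_fun setT (fun x => (f_ n x)%:E) by exact/measurable_EFinP.
transitivity (limn (fun n => \int[density_measure m mh h0]_x (f_ n x)%:E)).
  rewrite -monotone_convergence//=.
  - by apply: eq_integral => x _; apply/esym/cvg_lim.
  - by move=> n x _; rewrite lee_fin.
transitivity (limn (fun n => \int[m]_x ((f_ n x)%:E * (h x)%:E))); last first.
  rewrite -monotone_convergence//=.
  - apply: eq_integral => x _; apply/cvg_lim => //.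
    by apply: cvgeZr.
  - by move=> n; apply: emeasurable_funM => //; exact/measurable_EFinP.
  - by move=> n x _; rewrite mule_ge0// lee_fin.
  - by move=> x _ a b ab; rewrite lee_wpmul2r ?lee_fin//; exact/lefP/nd_nnsfun_approx.
congr (limn _); apply/funext => n.
transitivity (\sum_(r \in range (f_ n))
    \int[density_measure m mh h0]_x (r * \1_(f_ n @^-1` [set r]) x)%:E).
  under eq_integral do rewrite fimfunE -fsumEFin//.
  rewrite ge0_integral_fsum//.
  - by move=> y; exact/measurable_EFinP/measurable_funM.
  - by move=> y x _; rewrite EFinM nnfun_muleindic_ge0.
transitivity (\sum_(r \in range (f_ n))
    \int[m]_x ((r * \1_(f_ n @^-1` [set r]) x)%:E * (h x)%:E)); last first.
  rewrite -ge0_integral_fsum//.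
  - apply: eq_integral => x _; rewrite -ge0_mule_fsuml.
      by rewrite fsumEFin// -(fimfunE _ x).
    by move=> r; rewrite EFinM nnfun_muleindic_ge0.
  - move=> r; apply: emeasurable_funM; last exact/measurable_EFinP.
    exact/measurable_EFinP/measurable_funM.
  - by move=> y x _; apply: mule_ge0; [rewrite EFinM nnfun_muleindic_ge0|rewrite lee_fin].
apply: eq_fsbigr => r /[!inE] -[x0 _ fr].
have r0 : (0 <= r)%R by rewrite -fr.
have mA : measurable (f_ n @^-1` [set r]) by [].
under [LHS]eq_integral do rewrite EFinM.
rewrite ge0_integralZl//; last exact/measurable_EFinP.
rewrite integral_indic// setIT.
under [RHS]eq_integral do rewrite EFinM -muleA.
rewrite ge0_integralZl//; last 2 first.
- apply: emeasurable_funM; last exact/measurable_EFinP.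
  by apply/measurable_EFinP; exact: measurable_indic.
- by move=> x _; rewrite mule_ge0// lee_fin.
congr (_ * _).
transitivity (density_measure m mh h0 (f_ n @^-1` [set r])) => //.
rewrite /density_measure integral_mkcond.
by apply: eq_integral => x _; rewrite patchE indicE; case: (x \in _); rewrite ?mul1e ?mul0e.
Qed.

End density_is_measure.

(** [pushforward] as a term of measure type, the measurability of the map being
    an explicit argument instead of a side condition to be inferred. *)
Definition image_measure d1 d2 (X : measurableType d1) (Y : measurableType d2)
    (R : realType) (m : {measure set X -> \bar R}) (phi : X -> Y)
    (mphi : measurable_fun setT phi) : {measure set Y -> \bar R}.
Proof. by refine (pushforward m phi : {measure set Y -> \bar R}). Defined.

Lemma image_measureE d1 d2 (X : measurableType d1) (Y : measurableType d2)
    (R : realType) (m : {measure set X -> \bar R}) (phi : X -> Y)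
    (mphi : measurable_fun setT phi) A :
  image_measure m mphi A = m (phi @^-1` A).
Proof. by []. Qed.

Lemma ge0_integral_image d1 d2 (X : measurableType d1) (Y : measurableType d2)
    (R : realType) (m : {measure set X -> \bar R}) (phi : X -> Y)
    (mphi : measurable_fun setT phi) (f : Y -> \bar R) :
  measurable_fun setT f -> (forall y, (0 <= f y)%E) ->
  (\int[image_measure m mphi]_y f y = \int[m]_x f (phi x))%E.
Proof. by move=> mf f0; rewrite [LHS]ge0_integral_pushforward. Qed.

(** * Integration of products under a product law *)

Section product_law.
Context d (X : measurableType d) (R : realType) (n : nat).
Variables (N : {measure set X -> \bar R}) (mu : {measure set (n.-tuple X) -> \bar R}).
Hypothesis Nfin : fin_num_fun N.
Hypothesis muE : forall B : 'I_n -> set X, (forall i, measurable (B i)) ->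
  mu [set u | forall i, B i (tnth u i)] = (\prod_(i < n) N (B i))%E.

(** The product formula is known for indicators only.  The indicators are
    replaced by general factors one coordinate at a time: with the other factors
    fixed, both sides are finite measures of the set whose indicator stands at
    that coordinate, and integrals against equal measures agree.  Finite
    integrals are asked for so that the constant factor is a real number. *)
Lemma product_law_integral_prod (f : 'I_n -> X -> R) (c : 'I_n -> R) :
  (forall i, measurable_fun setT (f i)) -> (forall i x, 0 <= f i x) ->
  (forall i, \int[N]_x (f i x)%:E = (c i)%:E)%E ->
  (\int[mu]_u (\prod_(i < n) f i (tnth u i))%:E = (\prod_(i < n) c i)%:E)%E.
Proof.
(* the first k factors are arbitrary, the others are indicators *)
suff H k : forall (f : 'I_n -> X -> R) (c : 'I_n -> R),
    (forall i, measurable_fun setT (f i)) -> (forall i x, 0 <= f i x) ->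
    (forall i, \int[N]_x (f i x)%:E = (c i)%:E)%E ->
    (forall i : 'I_n, (k <= i)%N -> exists2 B, measurable B & f i = \1_B) ->
    (\int[mu]_u (\prod_(i < n) f i (tnth u i))%:E = (\prod_(i < n) c i)%:E)%E.
  move=> mf f0 fc; apply: (H n) => // i.
  by rewrite leqNgt ltn_ord.
elim: k => [|k IH] {}f {}c mf f0 fc fB.
  have /choice[B HB] : forall i, exists B, measurable B /\ f i = \1_B.
    by move=> i; have [B] := fB i (leq0n i); exists B.
  transitivity (\int[mu]_u (\1_[set u | forall i, B i (tnth u i)] u)%:E)%E.
    apply: eq_integral => u _; congr EFin; rewrite indicE.
    case: (boolP (u \in _)) => [/set_mem /= Bu|/negP Bu].
      by rewrite big1// => i _; rewrite (HB i).2 indicE mem_set.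
    have [i Bi] : exists i, ~ B i (tnth u i).
      by apply: contrapT => /forallNP H; apply: Bu; apply/mem_set => i; exact: contrapT (H i).
    by rewrite (bigD1 i)//= (HB i).2 indicE memNset// mul0r.
  have mB : measurable [set u : n.-tuple X | forall i, B i (tnth u i)].
    rewrite (_ : [set u | _] = \bigcap_(i in [set: 'I_n]) ((@tnth n X ^~ i) @^-1` B i)).
      apply: fin_bigcap_measurable => // i _.
      by rewrite -[X in measurable X]setTI; apply: measurable_tnth => //; exact: (HB i).1.
    by apply/seteqP; split => u /= Hu i => [_|]; apply: Hu.
  rewrite integral_indic// setIT muE; last by move=> i; exact: (HB i).1.
  rewrite -prodEFin; apply: eq_bigr => i _.
  by rewrite -fc (HB i).2 integral_indic ?setIT//; exact: (HB i).1.
have [nk|kn] := leqP n k.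
  by apply: IH => // i ki; have := ltn_ord i; rewrite ltnNge (leq_trans nk ki).
pose j := Ordinal kn.
have mc i : 0 <= c i.
  by rewrite -lee_fin -fc; apply: integral_ge0 => x _; rewrite lee_fin.
pose h (u : n.-tuple X) := \prod_(i < n | i != j) f i (tnth u i).
have h0 u : 0 <= h u by apply: prodr_ge0.
have mh : measurable_fun setT h.
  rewrite /h; under eq_fun do rewrite -big_filter.
  apply: measurable_prod => i _; apply: measurableT_comp => //.
  exact: measurable_tnth.
have mj := @measurable_tnth _ X n j.
have C0 : 0 <= \prod_(i < n | i != j) c i by apply: prodr_ge0.
(* as a function of the set at coordinate j, the left-hand side is the image
   under that coordinate of the measure with density the other factors *)
pose M := pushforward (density_measure mu mh h0) (@tnth n X ^~ j).
have ME B : measurable B -> M B = mscale (NngNum C0) N B.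
  move=> mB; pose f' i := if i == j then \1_B else f i.
  pose c' i := if i == j then fine (N B) else c i.
  transitivity (\int[mu]_u (\prod_(i < n) f' i (tnth u i))%:E)%E.
    rewrite /M /pushforward/= /density_measure integral_mkcond.
    apply: eq_integral => u _; rewrite patchE (bigD1 j)//= {1}/f' eqxx indicE.
    rewrite (eq_bigr (fun i => f i (tnth u i))); last by move=> i /negbTE; rewrite /f' => ->.
    rewrite -/(h u).
    have -> : (u \in (fun x : n.-tuple X => tnth x j) @^-1` B) = (tnth u j \in B).
      by apply/idP/idP => /set_mem Hu; apply/mem_set.
    by case: (_ \in _); rewrite ?mul1r ?mul0r.
  rewrite (IH f' c').
  - rewrite (bigD1 j)//= {1}/c' eqxx /mscale/= muleC EFinM fineK ?Nfin//.
    by congr (_ * _%:E)%E; apply: eq_bigr => i /negbTE; rewrite /c' => ->.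
  - by move=> i; rewrite /f'; case: ifP.
  - by move=> i x; rewrite /f'; case: ifP.
  - move=> i; rewrite /f' /c'; case: ifP => // _.
    by rewrite integral_indic// setIT fineK ?Nfin.
  - move=> i ki; rewrite /f'; case: ifP => [_|/eqP ij]; first by exists B.
    apply: fB; rewrite ltn_neqAle ki andbT; apply/eqP => kij.
    by apply: ij; apply/val_inj.
transitivity (\int[M]_x (f j x)%:E)%E.
  rewrite [RHS]ge0_integral_pushforward//=; last 2 first.
  - exact/measurable_EFinP.
  - by move=> x _; rewrite lee_fin.
  rewrite [RHS]ge0_integral_density//=; last 2 first.
  - by apply/measurable_EFinP; apply: measurableT_comp.
  - by move=> x; rewrite lee_fin.
  by apply: eq_integral => u _; rewrite (bigD1 j)//= EFinM.
rewrite (eq_measure_integral (mscale (NngNum C0) N)); last by move=> B mB _; exact: ME.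
rewrite ge0_integral_mscale//; last 2 first.
- exact/measurable_EFinP.
- by move=> x _; rewrite lee_fin.
by rewrite fc /= -EFinM mulrC [in RHS](bigD1 j).
Qed.

End product_law.

(** * The Euclidean norm and boxes *)

Section enorm_basics.
Context (R : realType) (n : nat).
Implicit Types (x y : 'rV[R]_n) (u : n.-tuple R).

Lemma dotp_ge0 x : 0 <= dotp x x.
Proof. by apply: sumr_ge0 => i _; rewrite -expr2 sqr_ge0. Qed.

Lemma enorm_ge0 x : 0 <= enorm x.
Proof. exact: sqrtr_ge0. Qed.

Lemma sqr_enorm x : enorm x ^+ 2 = dotp x x.
Proof. by rewrite sqr_sqrtr// dotp_ge0. Qed.

Lemma enormZ (t : R) x : enorm (t *: x) = `|t| * enorm x.
Proof.
rewrite -sqrtr_sqr -sqrtrM ?sqr_ge0//; congr Num.sqrt.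
by rewrite /dotp mulr_sumr; apply: eq_bigr => i _; rewrite !mxE; ring.
Qed.

Lemma enorm_vec u : enorm (vec u) = Num.sqrt (\sum_(i < n) tnth u i ^+ 2).
Proof. by congr Num.sqrt; apply: eq_bigr => i _; rewrite !mxE expr2. Qed.

Lemma sqr_enorm_vec u : enorm (vec u) ^+ 2 = \sum_(i < n) tnth u i ^+ 2.
Proof. by rewrite sqr_enorm; apply: eq_bigr => i _; rewrite !mxE expr2. Qed.

Lemma ler_tnth_enorm u i : `|tnth u i| <= enorm (vec u).
Proof.
rewrite enorm_vec -sqrtr_sqr ler_wsqrtr// (bigD1 i)//= lerDl.
by apply: sumr_ge0 => j _; rewrite sqr_ge0.
Qed.

Lemma measurable_enorm_vec : measurable_fun setT (fun u : n.-tuple R => enorm (vec u)).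
Proof.
under eq_fun do rewrite enorm_vec.
apply: measurableT_comp.
  apply: continuous_measurable_fun; exact: sqrt_continuous.
apply: measurable_sum => i; apply: measurable_funX; exact: measurable_tnth.
Qed.

End enorm_basics.

Section boxes.
Context (R : realType) (n : nat).

Definition box (a b : 'I_n -> R) : set (n.-tuple R) :=
  [set u | forall i, tnth u i \in `]a i, b i]].

Definition boxes : set (set (n.-tuple R)) :=
  [set A | exists a b, A = box a b].

Lemma measurable_box a b : measurable (box a b).
Proof.
rewrite (_ : box a b = \bigcap_(i in [set: 'I_n])
    ((@tnth n R ^~ i) @^-1` [set` `]a i, b i]])).
  apply: fin_bigcap_measurable => // i _.
  by rewrite -[X in measurable X]setTI; apply: measurable_tnth.
by apply/seteqP; split => u /= Hu i => [_|]; apply: Hu.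
Qed.

Lemma boxes_setI_closed : setI_closed boxes.
Proof.
move=> _ _ [a [b ->]] [a' [b' ->]].
exists (fun i => Num.max (a i) (a' i)), (fun i => Num.min (b i) (b' i)).
apply/seteqP; split => u /= => [[H H'] i|H].
  move: (H i) (H' i); rewrite !in_itv/= gt_max le_min.
  by move=> /andP[-> ->] /andP[-> ->].
split=> i; move: (H i); rewrite !in_itv/= gt_max le_min;
  by move=> /andP[/andP[h1 h2] /andP[h3 h4]]; rewrite ?h1 ?h2 ?h3 ?h4.
Qed.

Definition cube (k : nat) : set (n.-tuple R) :=
  box (fun=> - k%:R) (fun=> k%:R).

Lemma bigcup_cube : \bigcup_k cube k = setT.
Proof.
apply/seteqP; split => // u _.
exists (Num.truncn (enorm (vec u))).+1 => // i.
have := ler_tnth_enorm u i; have := truncnS_gt (enorm (vec u)).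
set k := _%:R => h1 h2; have := le_lt_trans h2 h1.
by rewrite in_itv/= ltr_norml => /andP[-> /ltW].
Qed.

(** Boxes with half-open bounded sides form the pi-system on which measures on
    tuples are compared: dilations map them to boxes and their volume is
    explicit. *)
Lemma measurable_boxesE : @measurable _ (n.-tuple R) = <<s boxes >>.
Proof.
apply/seteqP; split; last first.
  apply: smallest_sub; first exact: sigma_algebra_measurable.
  by move=> _ [a [b ->]]; exact: measurable_box.
have H : measurable_fun setT (id : g_sigma_algebraType boxes -> n.-tuple R).
  apply/measurable_fun_tnthP => i.
  apply: (@measurability _ _ _ _ _ _ (@ocitv R)) => // _ [_ [[a b] _ <-] <-].
  rewrite setTI (_ : _ @^-1` _ = \bigcup_k box
      (fun j => if j == i then a else - k%:R)
      (fun j => if j == i then b else k%:R)); last first.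
    apply/seteqP; split => u /=.
      move=> ui; have [k _ Hk] : (\bigcup_k cube k) u by rewrite bigcup_cube.
      exists k => // j; have := Hk j; case: eqP => [->|//] _.
      exact: ui.
    by move=> [k _ /(_ i)]; rewrite eqxx.
  apply: bigcup_measurable => k _; apply: sub_sigma_algebra.
  by do 2 eexists.
by move=> A mA; rewrite -(setTI A) -[A]/(id @^-1` A); apply: H.
Qed.

End boxes.

(** * The Gaussian law turned into Lebesgue measure *)

Definition tscale (R : realType) (n : nat) (t : R) (u : n.-tuple R) : n.-tuple R :=
  [tuple t * tnth u i | i < n].

Section tscale_theory.
Context (R : realType) (n : nat).
Implicit Types (t : R) (u : n.-tuple R).

Lemma vec_tscale t u : vec (tscale t u) = t *: vec u.
Proof. by apply/rowP => i; rewrite !mxE tnth_mktuple. Qed.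

Lemma measurable_tscale t : measurable_fun setT (@tscale R n t).
Proof.
apply/measurable_fun_tnthP => i.
rewrite (_ : _ \o _ = fun u => t * tnth u i); last first.
  by apply/funext => u /=; rewrite tnth_mktuple.
by apply: measurable_funM => //; exact: measurable_tnth.
Qed.

Lemma preimage_tscale_box t (a b : 'I_n -> R) : 0 < t ->
  tscale t @^-1` box a b = box (fun i => t^-1 * a i) (fun i => t^-1 * b i).
Proof.
move=> t0; apply/seteqP; split => u /= H i; move: (H i);
  by rewrite tnth_mktuple !in_itv/= !ler_pdivlMl// !ltr_pdivrMl.
Qed.

End tscale_theory.

(** Up to a constant factor, the reciprocal of the Gaussian density: it is
    exp(|u|^2 / 2 s^2), see [gauss_weightE]. *)
Definition gauss_weight (R : realType) (s : R) (n : nat) (u : n.-tuple R) : R :=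
  \prod_(i < n) expR (tnth u i ^+ 2 / (s ^+ 2 *+ 2)).

Section gauss_weight_theory.
Context (R : realType) (s : R) (n : nat).
Implicit Types u : n.-tuple R.

Lemma gauss_weightE u :
  gauss_weight s u = expR (enorm (vec u) ^+ 2 / (s ^+ 2 *+ 2)).
Proof. by rewrite sqr_enorm_vec mulr_suml expR_sum. Qed.

Lemma gauss_weight_ge1 u : 1 <= gauss_weight s u.
Proof.
by rewrite gauss_weightE -expR0 ler_expR divr_ge0 ?sqr_ge0// mulrn_wge0 ?sqr_ge0.
Qed.

Lemma gauss_weight_ge0 u : 0 <= gauss_weight s u.
Proof. exact: le_trans ler01 (gauss_weight_ge1 u). Qed.

Lemma measurable_gauss_weight1 :
  measurable_fun setT (fun x : R => expR (x ^+ 2 / (s ^+ 2 *+ 2))).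
Proof.
apply: measurableT_comp; first exact: measurable_expR.
by apply: measurable_funM => //; exact: measurable_funX.
Qed.

Lemma measurable_gauss_weight : measurable_fun setT (@gauss_weight R s n).
Proof.
apply: measurable_prod => i _.
by apply: (measurableT_comp measurable_gauss_weight1); exact: measurable_tnth.
Qed.

End gauss_weight_theory.

Section gauss_lebesgue.
Context (R : realType) (s : R) (n : nat).
Hypothesis s0 : 0 < s.
Variable mu : {measure set (n.-tuple R) -> \bar R}.
Hypothesis muE : forall B : 'I_n -> set R, (forall i, measurable (B i)) ->
  mu [set u | forall i, B i (tnth u i)] = (\prod_(i < n) normal_prob 0 s (B i))%E.

(** A multiple of Lebesgue measure on R^n, built from the Gaussian law. *)
Definition flat_measure :=
  density_measure mu (@measurable_gauss_weight R s n) (@gauss_weight_ge0 R s n).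

HB.instance Definition _ := Measure.on flat_measure.

(** The weight cancels the exponential in the normal density. *)
Lemma normal_weight_integral (B : set R) : measurable B ->
  (\int[normal_prob 0 s]_x (\1_B x * expR (x ^+ 2 / (s ^+ 2 *+ 2)))%:E =
   (normal_peak s)%:E * lebesgue_measure B)%E.
Proof.
move=> mB.
have mpdf := measurable_normal_pdf (0:R) s.
have mw := measurable_gauss_weight1 s.
rewrite (eq_measure_integral (density_measure lebesgue_measure mpdf
  (normal_pdf_ge0 0 s))); last by [].
rewrite ge0_integral_density; last 2 first.
- by apply/measurable_EFinP; apply: measurable_funM => //.
- by move=> x; rewrite lee_fin mulr_ge0// expR_ge0.
transitivity (\int[lebesgue_measure]_(x in B) (normal_peak s)%:E)%E; last first.
  by rewrite integral_cst.
rewrite [RHS]integral_mkcond; apply: eq_integral => x _.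
rewrite patchE indicE; case: (x \in B); rewrite ?mul0r ?mul0e// mul1r.
rewrite normal_pdfE ?gt_eqF// /normal_fun subr0 -EFinM mulrCA -expRD mulNr.
by rewrite subrr expR0 mulr1.
Qed.

Lemma flat_box (a b : 'I_n -> R) :
  flat_measure (box a b) = (\prod_(i < n)
    (normal_peak s * fine (lebesgue_measure `]a i, b i]%classic)))%:E.
Proof.
pose f i (x : R) := \1_(`]a i, b i]%classic) x * expR (x ^+ 2 / (s ^+ 2 *+ 2)).
have mw := measurable_gauss_weight1 s.
have mid : measurable_fun setT (id : measurableTypeR R -> R) by [].
pose N := pushforward (normal_prob 0 s) (id : measurableTypeR R -> R).
have mf i : measurable_fun setT (f i) by apply: measurable_funM.
have f0 i x : 0 <= f i x by rewrite mulr_ge0// expR_ge0.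
rewrite -(@product_law_integral_prod _ _ _ n N mu _ _ f)//; last 2 first.
- by move=> B mB; exact: (fin_num_measure (normal_prob 0 s)).
- move=> i; rewrite ge0_integral_pushforward//=; last 2 first.
  + exact/measurable_EFinP.
  + by move=> x _; rewrite lee_fin.
  rewrite preimage_setT normal_weight_integral// EFinM fineK//.
  by rewrite lebesgue_measure_itv/=; case: ifP.
rewrite /flat_measure/= /density_measure integral_mkcond.
apply: eq_integral => u _; rewrite patchE /f big_split/= -/(gauss_weight s u).
case: (boolP (u \in _)) => [/set_mem uab|/negP uab].
  by rewrite big1 ?mul1r// => i _; rewrite indicE mem_set//; exact: uab.
have [i Bi] : exists i, ~ (tnth u i \in `]a i, b i]).
  by apply: contrapT => /forallNP H; apply: uab; apply/mem_set => i; exact: contrapT (H i).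
by rewrite (bigD1 i)//= indicE memNset// mul0r mul0r.
Qed.

(** A dilation multiplies the volume of boxes by the same power of its ratio,
    and boxes determine the measure. *)
Lemma flat_scale (t : R) (A : set (n.-tuple R)) : 0 < t -> measurable A ->
  flat_measure (tscale t @^-1` A) = ((t^-1 ^+ n)%:E * flat_measure A)%E.
Proof.
move=> t0.
have t0' : 0 <= t^-1 ^+ n by rewrite exprn_ge0// invr_ge0 ltW.
have mt := @measurable_tscale R n t.
have fin_cube a b : (flat_measure (box a b) < +oo)%E by rewrite flat_box ltry.
move=> mA.
apply: (@measure_unique _ _ _ (@boxes R n) (@cube R n) (@measurable_boxesE R n)
  (@boxes_setI_closed R n) _ (@bigcup_cube R n) (image_measure flat_measure mt)
  (mscale (NngNum t0') flat_measure)) => //.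
- by move=> k; do 2 eexists.
- move=> _ [a [b ->]]; rewrite image_measureE preimage_tscale_box//.
  rewrite -[RHS]/((t^-1 ^+ n)%:E * flat_measure (box a b))%E flat_box -EFinM.
  apply: (etrans (flat_box _ _)); congr EFin.
  have -> : t^-1 ^+ n = \prod_(i < n) t^-1 by rewrite prodr_const card_ord.
  rewrite -big_split/=; apply: eq_bigr => i _; rewrite mulrCA; congr (_ * _).
  rewrite !lebesgue_measure_itv/= !lte_fin ltr_pM2l ?invr_gt0//.
  by case: ifP; rewrite ?mulr0//= mulrBr.
- by move=> k; rewrite image_measureE preimage_tscale_box.
Qed.

End gauss_lebesgue.

(** * Independence of radius and direction *)

Section radial_angular.
Context (R : realType) (s : R) (n : nat).
Hypothesis s0 : 0 < s.
Variable mu : {measure set (n.-tuple R) -> \bar R}.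
Hypothesis muE : forall B : 'I_n -> set R, (forall i, measurable (B i)) ->
  mu [set u | forall i, B i (tnth u i)] = (\prod_(i < n) normal_prob 0 s (B i))%E.

Local Notation lam := (flat_measure s mu).
Local Notation nrm := (fun u : n.-tuple R => enorm (vec u)).
Local Notation menorm := (@measurable_enorm_vec R n).

Lemma product_law_setT : mu setT = 1%E.
Proof.
have := muE (B := fun=> setT) (fun=> measurableT).
rewrite big1 => [<-|i _]; last exact: (@probability_setT _ _ _ (normal_prob 0 s)).
by congr (mu _); apply/seteqP; split.
Qed.

Definition oball (t : R) : set (n.-tuple R) := [set u | enorm (vec u) < t].

Lemma measurable_oball t : measurable (oball t).
Proof.
rewrite (_ : oball t = nrm @^-1` [set` `]-oo, t[]); last first.
  by apply/seteqP; split => u /=; rewrite in_itv.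
by rewrite -[X in measurable X]setTI; apply: menorm.
Qed.

Lemma flat_oball_fin t : (lam (oball t) < +oo)%E.
Proof.
apply: (@le_lt_trans _ _ (lam (box (fun=> - t) (fun=> t)))).
  apply: le_measure; rewrite ?inE; [exact: measurable_oball|exact: measurable_box|].
  move=> u ut i; rewrite in_itv/=.
  have := le_lt_trans (ler_tnth_enorm u i) ut.
  by rewrite ltr_norml => /andP[-> /ltW].
by rewrite flat_box// ltry.
Qed.

(** A function of the direction is represented by a function g that is
    homogeneous of degree 0. *)
Section angular.
Variable g : n.-tuple R -> R.
Hypotheses (mg : measurable_fun setT g) (g0 : forall u, 0 <= g u)
  (g1 : forall u, g u <= 1).
Hypothesis g_hom : forall t u, 0 < t -> g (tscale t u) = g u.

Definition ball_moment (t : R) : \bar R :=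
  (\int[lam]_u (\1_(oball t) u * g u)%:E)%E.

Lemma measurable_ball_moment t :
  measurable_fun setT (fun u => (\1_(oball t) u * g u)%:E).
Proof.
apply/measurable_EFinP; apply: measurable_funM => //.
by apply: measurable_indic; exact: measurable_oball.
Qed.

Lemma ball_moment_fin t : ball_moment t \is a fin_num.
Proof.
have p0 u : 0 <= \1_(oball t) u * g u by rewrite mulr_ge0.
rewrite ge0_fin_numE; last by apply: integral_ge0 => u _; rewrite lee_fin.
apply: (@le_lt_trans _ _ (\int[lam]_u (\1_(oball t) u)%:E)%E).
  apply: ge0_le_integral => //.
  - by move=> u _; rewrite lee_fin.
  - exact: measurable_ball_moment.
  - by apply/measurable_EFinP; apply: measurable_indic; exact: measurable_oball.
  - by move=> u _; rewrite lee_fin ler_piMr.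
by rewrite integral_indic ?setIT ?flat_oball_fin//; exact: measurable_oball.
Qed.

(** The dilation by t maps the unit ball onto the ball of radius t and does not
    change g. *)
Lemma ball_momentE t : 0 < t -> ball_moment t = ((t ^+ n)%:E * ball_moment 1)%E.
Proof.
move=> t0.
have t0' : 0 <= t^-1 ^+ n by rewrite exprn_ge0// invr_ge0 ltW.
have mt := @measurable_tscale R n t.
have p0 u : (0 <= (\1_(oball t) u * g u)%:E)%E by rewrite lee_fin mulr_ge0.
have -> : ball_moment 1 = (\int[image_measure lam mt]_u (\1_(oball t) u * g u)%:E)%E.
  rewrite ge0_integral_image//; last exact: measurable_ball_moment.
  apply: eq_integral => u _; rewrite g_hom// !indicE; congr ((_%:R * _)%:E).
  have H : oball 1 u <-> oball t (tscale t u).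
    by rewrite /oball/= vec_tscale enormZ gtr0_norm// -ltr_pdivlMl// mulVf ?gt_eqF.
  by congr nat_of_bool; apply/idP/idP => /set_mem /H ?; apply/mem_set.
rewrite (eq_measure_integral (mscale (NngNum t0') lam)); last first.
  by move=> A mA _; exact: flat_scale.
rewrite ge0_integral_mscale//; last exact: measurable_ball_moment.
by rewrite muleA -EFinM -exprMn divff ?gt_eqF// expr1n mul1e.
Qed.

(** Law of the radius when the direction is weighted by g. *)
Definition radial_law : {measure set R -> \bar R} :=
  image_measure (density_measure lam mg g0) menorm.

Lemma radial_law_ray t : radial_law `]-oo, t[%classic = ball_moment t.
Proof.
rewrite image_measureE /=/density_measure integral_mkcond.
apply: eq_integral => u _; rewrite patchE indicE.
have -> : (u \in nrm @^-1` [set` `]-oo, t[]) = (u \in oball t).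
  by apply/idP/idP => /set_mem H; apply/mem_set; move: H; rewrite /oball/= in_itv.
by case: (_ \in _); rewrite ?mul1r ?mul0r.
Qed.

Lemma radial_law_ray0 t : t <= 0 -> radial_law `]-oo, t[%classic = 0%E.
Proof.
move=> t0; rewrite radial_law_ray /ball_moment integral0_eq// => u _.
rewrite indicE memNset ?mul0r// /oball/= => ut.
by have := lt_le_trans (le_lt_trans (enorm_ge0 _) ut) t0; rewrite ltxx.
Qed.

(** The exponential, a function of the radius, undoes the reweighting that led
    from the Gaussian law to [flat_measure]. *)
Lemma integral_radial_law (w : R -> R) : measurable_fun setT w -> (forall x, 0 <= w x) ->
  (\int[radial_law]_x (w x * expR (- (x ^+ 2 / (s ^+ 2 *+ 2))))%:E =
   \int[mu]_u (w (enorm (vec u)) * g u)%:E)%E.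
Proof.
move=> mw w0.
have mwe : measurable_fun setT (fun x : R => w x * expR (- (x ^+ 2 / (s ^+ 2 *+ 2)))).
  apply: measurable_funM => //; apply: measurableT_comp; first exact: measurable_expR.
  apply: measurableT_comp => //.
  by apply: measurable_funM => //; exact: measurable_funX.
have we0 x : 0 <= w x * expR (- (x ^+ 2 / (s ^+ 2 *+ 2))).
  by rewrite mulr_ge0// expR_ge0.
have mwen := measurableT_comp mwe menorm.
rewrite ge0_integral_image; [|exact/measurable_EFinP|by move=> x; rewrite lee_fin].
rewrite ge0_integral_density; [|exact/measurable_EFinP|by move=> x; rewrite lee_fin].
under eq_integral do rewrite -EFinM.
rewrite ge0_integral_density; last 2 first.
- by apply/measurable_EFinP; apply: measurable_funM.
- by move=> u; rewrite lee_fin mulr_ge0.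
apply: eq_integral => u _; rewrite -EFinM gauss_weightE; congr EFin.
by rewrite -!mulrA; congr (_ * _); rewrite mulrCA -expRD addNr expR0 mulr1.
Qed.

End angular.

Local Notation one := (fun=> 1 : R).
Let m1 : measurable_fun setT (one : n.-tuple R -> R). Proof. exact: measurable_cst. Qed.
Let one0 (u : n.-tuple R) : 0 <= one u. Proof. exact: ler01. Qed.

Lemma ball_moment_oneE t : ball_moment one t = lam (oball t).
Proof.
rewrite /ball_moment; under eq_integral do rewrite mulr1.
by rewrite integral_indic ?setIT//; exact: measurable_oball.
Qed.

Lemma flat_oball t : 0 < t -> lam (oball t) = ((t ^+ n)%:E * lam (oball 1))%E.
Proof. by move=> t0; rewrite -!ball_moment_oneE (ball_momentE m1). Qed.

Lemma flat_oball1_gt0 : (0 < lam (oball 1))%E.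
Proof.
have k0 : 0 < n.+1%:R :> R by [].
suff : (0 < lam (oball n.+1%:R))%E.
  by rewrite flat_oball// pmule_rgt0// lte_fin exprn_gt0.
apply: (@lt_le_trans _ _ (lam (box (fun=> 0) (fun=> 1)))).
  rewrite flat_box// lte_fin prodr_gt0// => i _.
  by rewrite lebesgue_measure_itv/= lte_fin ltr01/= subr0 mulr1 normal_peak_gt0 ?gt_eqF.
apply: le_measure; rewrite ?inE; [exact: measurable_box|exact: measurable_oball|].
move=> u u01; rewrite /oball/= -(@ltr_pXn2r _ 2)// ?nnegrE ?enorm_ge0//.
rewrite sqr_enorm_vec; apply: (@le_lt_trans _ _ n%:R).
  rewrite -[n in leRHS]card_ord -sum1_card natr_sum; apply: ler_sum => i _.
  have := u01 i; rewrite in_itv/= => /andP[u0 u1].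
  by rewrite expr_le1// ltW.
by rewrite -natrX ltr_nat -mulnn mulSn ltn_addr.
Qed.

(** By [ball_momentE] both radial laws give the ray below t a mass proportional
    to t^n, and rays determine a measure on the line. *)
Lemma radial_law_prop (g : n.-tuple R -> R) (mg : measurable_fun setT g)
    (g0 : forall u, 0 <= g u) (g1 : forall u, g u <= 1)
    (g_hom : forall t u, 0 < t -> g (tscale t u) = g u) A : measurable A ->
  (lam (oball 1) * radial_law mg g0 A = ball_moment g 1 * radial_law m1 one0 A)%E.
Proof.
move=> mA.
have gfin := ball_moment_fin mg g0 g1 1.
have ffin : lam (oball 1) \is a fin_num by rewrite ge0_fin_numE ?flat_oball_fin.
have c0 : 0 <= fine (lam (oball 1)) by rewrite fine_ge0.
have cg0 : 0 <= fine (ball_moment g 1).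
  by rewrite fine_ge0// integral_ge0// => u _; rewrite lee_fin mulr_ge0.
have E1 B : (lam (oball 1) * radial_law mg g0 B)%E =
    mscale (NngNum c0) (radial_law mg g0) B by rewrite /mscale/= fineK.
have E2 B : (ball_moment g 1 * radial_law m1 one0 B)%E =
    mscale (NngNum cg0) (radial_law m1 one0) B by rewrite /mscale/= fineK.
rewrite E1 E2.
apply: (@measure_unique _ _ _ (@RGenInftyO.G R) (fun k => `]-oo, k%:R[%classic)
  (@RGenInftyO.measurableE R)) => //.
- move=> _ _ [x ->] [y ->]; exists (Num.min x y).
  by apply/seteqP; split => z /=; rewrite !in_itv/= lt_min => /andP.
- by move=> k; exists k%:R.
- apply/seteqP; split => // x _; exists (Num.truncn x).+1 => //=.
  by rewrite in_itv/= truncnS_gt.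
- move=> _ [x ->]; apply: (etrans (esym (E1 _))); apply: (etrans _ (E2 _)).
  have [x0|x0] := leP x 0; first by rewrite !radial_law_ray0// !mule0.
  rewrite !radial_law_ray (ball_momentE mg)// (ball_momentE m1)//.
  by rewrite ball_moment_oneE muleCA [RHS]muleCA; congr (_ * _)%E; exact: muleC.
- move=> k; apply: (@le_lt_trans _ _ (lam (oball 1) * ball_moment g k%:R)%E).
    by rewrite -radial_law_ray E1.
  by rewrite ltey_eq fin_numM// (ball_moment_fin mg).
Qed.

(** The proportionality of the radial laws gives the product formula up to a
    constant depending on g; the case w = 1 identifies the constant. *)
Lemma radial_angular_indep (g : n.-tuple R -> R) (w : R -> R) :
  measurable_fun setT g -> (forall u, 0 <= g u) -> (forall u, g u <= 1) ->
  (forall t u, 0 < t -> g (tscale t u) = g u) ->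
  measurable_fun setT w -> (forall x, 0 <= w x) ->
  (\int[mu]_u (w (enorm (vec u)) * g u)%:E =
   \int[mu]_u (w (enorm (vec u)))%:E * \int[mu]_u (g u)%:E)%E.
Proof.
move=> mg g0 g1 g_hom mw w0.
have gfin := ball_moment_fin mg g0 g1 1.
have ffin : lam (oball 1) \is a fin_num by rewrite ge0_fin_numE ?flat_oball_fin.
have c0 : 0 <= fine (lam (oball 1)) by rewrite fine_ge0.
have cg0 : 0 <= fine (ball_moment g 1).
  by rewrite fine_ge0// integral_ge0// => u _; rewrite lee_fin mulr_ge0.
have key (v : R -> R) : measurable_fun setT v -> (forall x, 0 <= v x) ->
  (lam (oball 1) * \int[mu]_u (v (enorm (vec u)) * g u)%:E =
   ball_moment g 1 * \int[mu]_u (v (enorm (vec u)))%:E)%E.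
  move=> mv v0.
  have mve : measurable_fun setT (fun x : R => v x * expR (- (x ^+ 2 / (s ^+ 2 *+ 2)))).
    apply: measurable_funM => //; apply: measurableT_comp; first exact: measurable_expR.
    apply: measurableT_comp => //.
    by apply: measurable_funM => //; exact: measurable_funX.
  have ve0 x : 0 <= v x * expR (- (x ^+ 2 / (s ^+ 2 *+ 2))).
    by rewrite mulr_ge0// expR_ge0.
  under [in RHS]eq_integral do rewrite -[v _]mulr1.
  rewrite -(integral_radial_law mg g0)// -(integral_radial_law m1 one0)//.
  transitivity (\int[mscale (NngNum c0) (radial_law mg g0)]_x
    (v x * expR (- (x ^+ 2 / (s ^+ 2 *+ 2))))%:E)%E.
    rewrite ge0_integral_mscale//=; [by rewrite fineK|exact/measurable_EFinP|].
    by move=> x _; rewrite lee_fin.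
  rewrite (eq_measure_integral (mscale (NngNum cg0) (radial_law m1 one0))).
    rewrite ge0_integral_mscale//=; [by rewrite fineK|exact/measurable_EFinP|].
    by move=> x _; rewrite lee_fin.
  move=> A mA _; have := radial_law_prop mg g0 g1 g_hom mA.
  rewrite -{1}(fineK ffin) -{1}(fineK gfin).
  exact.
have c10 := flat_oball1_gt0.
have mone : measurable_fun [set: R] (fun=> 1 : R) by exact: measurable_cst.
have := key (fun=> 1) mone (fun=> ler01).
under eq_integral do rewrite mul1r.
rewrite integral_cst// product_law_setT !mule1 => cg.
have := key _ mw w0; rewrite -cg -muleA.
move=> /(congr1 (fun x => (fine (lam (oball 1)))^-1%:E * x)%E).
rewrite !muleA -[X in (_ * X * _ = _)%E](fineK ffin) -[X in (_ = _ * X * _ * _)%E](fineK ffin).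
rewrite -!EFinM mulVf ?mul1e => [->|]; first by rewrite muleC.
by rewrite gt_eqF// fine_gt0// c10/= -ge0_fin_numE.
Qed.

End radial_angular.

(** * The cost of a pair of points *)

Section euclidean.
Context (R : realType) (n : nat).
Implicit Types (x y z : 'rV[R]_n) (c : R).

Lemma dotpC x y : dotp x y = dotp y x.
Proof. by apply: eq_bigr => i _; rewrite mulrC. Qed.

Lemma dotpDl x y z : dotp (x + y) z = dotp x z + dotp y z.
Proof. by rewrite -big_split; apply: eq_bigr => i _; rewrite !mxE mulrDl. Qed.

Lemma dotpZl c x y : dotp (c *: x) y = c * dotp x y.
Proof. by rewrite mulr_sumr; apply: eq_bigr => i _; rewrite !mxE mulrA. Qed.

Lemma dotpNl x y : dotp (- x) y = - dotp x y.
Proof. by rewrite -scaleN1r dotpZl mulN1r. Qed.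

Lemma dotpDr x y z : dotp z (x + y) = dotp z x + dotp z y.
Proof. by rewrite dotpC dotpDl !(dotpC z). Qed.

Lemma dotpZr c x y : dotp x (c *: y) = c * dotp x y.
Proof. by rewrite dotpC dotpZl dotpC. Qed.

Lemma dotpNr x y : dotp x (- y) = - dotp x y.
Proof. by rewrite dotpC dotpNl dotpC. Qed.

Definition dotpE := (dotpDl, dotpDr, dotpNl, dotpNr, dotpZl, dotpZr).

Lemma enorm_eq0 x : enorm x = 0 -> x = 0.
Proof.
move=> x0; apply/rowP => i; rewrite mxE; apply/eqP; rewrite -sqrf_eq0.
have : dotp x x = 0 by rewrite -sqr_enorm x0 expr0n.
move/eqP; rewrite psumr_eq0 => [/allP /(_ i)|j _]; last by rewrite -expr2 sqr_ge0.
by rewrite mem_index_enum -expr2 => /(_ isT).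
Qed.

Lemma dotp_enorm x y : dotp x y <= enorm x * enorm y.
Proof.
have [x0|x0] := eqVneq (enorm x) 0.
  by rewrite x0 mul0r (enorm_eq0 x0) -(scale0r (0 : 'rV[R]_n)) dotpZl mul0r.
have [y0|y0] := eqVneq (enorm y) 0.
  by rewrite y0 mulr0 (enorm_eq0 y0) -(scale0r (0 : 'rV[R]_n)) dotpZr mul0r.
have xy0 : 0 < enorm x * enorm y.
  by rewrite mulr_gt0// lt_neqAle enorm_ge0 eq_sym ?x0 ?y0.
have := dotp_ge0 (enorm y *: x - enorm x *: y).
rewrite !dotpE -!sqr_enorm (dotpC y x) => H.
rewrite -(ler_pM2l xy0); nra.
Qed.

Lemma normr_dotp_enorm x y : `|dotp x y| <= enorm x * enorm y.
Proof.
rewrite ler_norml dotp_enorm andbT lerNl -dotpNl.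
by apply: (le_trans (dotp_enorm _ _)); rewrite -scaleN1r enormZ normrN1 mul1r.
Qed.

Lemma enormN x : enorm (- x) = enorm x.
Proof. by rewrite -scaleN1r enormZ normrN1 mul1r. Qed.

Lemma ler_enormD x y : enorm (x + y) <= enorm x + enorm y.
Proof.
rewrite -(@ler_pXn2r _ 2)// ?nnegrE ?addr_ge0 ?enorm_ge0//.
rewrite sqr_enorm !dotpE -!sqr_enorm (dotpC y x).
by have := dotp_enorm x y; nra.
Qed.

Lemma ler_enorm_dist x y : `|enorm x - enorm y| <= enorm (x - y).
Proof.
have h1 := ler_enormD (x - y) y; have h2 := ler_enormD (y - x) x.
move: h1 h2; rewrite !subrK -(opprB x y) enormN ler_norml => h1 h2.
by apply/andP; split; lra.
Qed.

Lemma sqr_enorm_along (a0 th : 'rV[R]_n) (al : R) : enorm th = 1 ->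
  enorm (a0 + al *: th) ^+ 2 = enorm a0 ^+ 2 + 2 * al * dotp th a0 + al ^+ 2.
Proof. by move=> th1; rewrite sqr_enorm !dotpE -!sqr_enorm th1 (dotpC a0); ring. Qed.

(** The integrand of the denominator of the cost ratio. *)
Definition excess x y : R := enorm x * enorm y - dotp x y.

Lemma excess_ge0 x y : 0 <= excess x y.
Proof. by rewrite subr_ge0 dotp_enorm. Qed.

(** Shows that the excess is of second order in y - x, and that its leading
    term only involves the derivative of the norm. *)
Lemma excessE x y :
  excess x y = (enorm (y - x) ^+ 2 - (enorm y - enorm x) ^+ 2) / 2.
Proof.
rewrite /excess sqr_enorm !dotpE -!sqr_enorm (dotpC y x). by field.
Qed.

Lemma excess_le x y : excess x y <= enorm (y - x) ^+ 2 / 2.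
Proof. by rewrite excessE ler_pM2r ?invr_gt0// gerBl sqr_ge0. Qed.

Definition unitdir x := (enorm x)^-1 *: x.

Lemma enorm_unitdir x : enorm x != 0 -> enorm (unitdir x) = 1.
Proof. by move=> x0; rewrite enormZ normfV ger0_norm ?enorm_ge0// mulVf. Qed.

(** The squared sine of the angle between th and a when th is a unit vector.
    The first term is not replaced by 1, so that th = 0, which is the direction
    given to the origin, has sine 0 and obeys the same bounds. *)
Definition sin2 (th a : 'rV[R]_n) := enorm th ^+ 2 - (dotp th a / enorm a) ^+ 2.

Lemma cos_le_enorm (th a : 'rV[R]_n) : `|dotp th a / enorm a| <= enorm th.
Proof.
have [->|a0] := eqVneq (enorm a) 0; first by rewrite invr0 mulr0 normr0 enorm_ge0.
have a0' : 0 < enorm a by rewrite lt_neqAle eq_sym a0 enorm_ge0.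
rewrite normrM normfV (ger0_norm (enorm_ge0 a)) ler_pdivrMr//.
exact: normr_dotp_enorm.
Qed.

Lemma sin2_itv (th a : 'rV[R]_n) : enorm th <= 1 -> 0 <= sin2 th a <= 1.
Proof.
move=> th1; rewrite /sin2 subr_ge0 -(real_normK (num_real (_ / _))).
rewrite ler_sqr ?nnegrE ?enorm_ge0// cos_le_enorm/=.
by rewrite lerBlDr (le_trans (_ : _ <= 1)) ?expr_le1 ?enorm_ge0// lerDl sqr_ge0.
Qed.

End euclidean.

(** Comparison of a difference quotient of the norm with its derivative.  In the
    application th is a unit vector, A0 = |a0|, p0 = th.a0, and A and B are the
    norms of a0 + al th and a0 + be th.  Then B - A = (be - al) m with
    m = (2 p0 + al + be)/(A + B), and m is within 4 e / k of the cosine p0/A0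
    because A and B are within e of A0, which is at least k. *)
Lemma radial_core (R : realType) (A0 A B p0 al be e k : R) :
  0 < k -> 2 * e <= k -> k <= A0 -> 0 <= al <= e -> 0 <= be <= e ->
  0 <= A -> 0 <= B ->
  A ^+ 2 = A0 ^+ 2 + 2 * al * p0 + al ^+ 2 ->
  B ^+ 2 = A0 ^+ 2 + 2 * be * p0 + be ^+ 2 ->
  `|p0| <= A0 -> `|p0 + al| <= A -> `|p0 + be| <= B ->
  `|A - A0| <= al -> `|B - A0| <= be ->
  `|((be - al) ^+ 2 - (B - A) ^+ 2) / 2 - (be - al) ^+ 2 * (1 - (p0 / A0) ^+ 2) / 2|
    <= (be - al) ^+ 2 * (4 * e / k).
Proof.
move=> k0 ek kA /andP[al0 ale] /andP[be0 bee] A_ge0 B_ge0 hA hB hp hpa hpb hAA hBA.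
have A0_gt0 : 0 < A0 by lra.
have /andP[h1 h2] : - al <= A - A0 <= al by rewrite -ler_norml.
have /andP[h3 h4] : - be <= B - A0 <= be by rewrite -ler_norml.
have S0 : 0 < A + B by lra.
pose m := (2 * p0 + al + be) / (A + B); pose m0 := p0 / A0.
have BAE : B - A = (be - al) * m.
  apply: (mulIf (lt0r_neq0 S0)); rewrite /m -mulrA divfK ?gt_eqF//; nra.
have m1 : `|m| <= 1.
  rewrite /m normrM normfV (gtr0_norm S0) ler_pdivrMr// mul1r.
  have -> : 2 * p0 + al + be = (p0 + al) + (p0 + be) by ring.
  by apply: (le_trans (ler_normD _ _)); rewrite lerD.
have m01 : `|m0| <= 1.
  by rewrite /m0 normrM normfV (gtr0_norm A0_gt0) ler_pdivrMr// mul1r.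
have p0E : p0 = m0 * A0 by rewrite /m0 divfK// gt_eqF.
have dm : `|m - m0| <= 4 * e / k.
  have -> : m - m0 = (al + be - m0 * ((A - A0) + (B - A0))) / (A + B).
    apply: (mulIf (lt0r_neq0 S0)); rewrite mulrBl /m !divfK ?gt_eqF// p0E; ring.
  rewrite normrM normfV (gtr0_norm S0).
  have h5 : `|al + be - m0 * ((A - A0) + (B - A0))| <= 4 * e.
    apply: (le_trans (ler_normB _ _)); rewrite normrM.
    have : `|m0| * `|A - A0 + (B - A0)| <= `|A - A0 + (B - A0)|.
      by rewrite ler_piMl.
    have := ler_normD (A - A0) (B - A0).
    rewrite (ger0_norm (addr_ge0 al0 be0)); lra.
  apply: ler_pM => //; first by rewrite invr_ge0 ltW.
  by rewrite lef_pV2 ?posrE//; lra.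
have -> : ((be - al) ^+ 2 - (B - A) ^+ 2) / 2 -
    (be - al) ^+ 2 * (1 - (p0 / A0) ^+ 2) / 2 =
    (be - al) ^+ 2 * ((m0 - m) * (m0 + m) / 2).
  by rewrite BAE -/m0; field.
rewrite normrM (ger0_norm (sqr_ge0 _)) ler_wpM2l ?sqr_ge0//.
rewrite !normrM distrC (@gtr0_norm _ 2^-1) ?invr_gt0//.
have : `|m0 + m| <= 2 by apply: (le_trans (ler_normD _ _)); lra.
have := normr_ge0 (m0 + m); have := normr_ge0 (m - m0); nra.
Qed.

(** [collapse] is the map that takes U to V, the shell r <= |x| <= r' being sent
    to the sphere of radius rb. *)
Section collapse.
Context (R : realType) (n : nat) (r r' rb : R).
Hypotheses (r0 : 0 < r) (rr' : r < r') (rbin : r <= rb <= r').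
Implicit Types (x y : 'rV[R]_n).

Definition in_shell x : bool := r <= enorm x <= r'.
Definition radial_gap x : R := if in_shell x then rb - enorm x else 0.
Definition collapse x : 'rV[R]_n :=
  (if in_shell x then rb else enorm x) *: unitdir x.
Definition pair_cost x y : R := excess (x - y) (collapse x - collapse y).
(** Limit, as the shell shrinks to the sphere of radius r, of twice the pair
    cost over the squared gap of x, for x in the shell with a given direction
    and y off that sphere. *)
Definition sin2_at x y : R := sin2 (unitdir x) (r *: unitdir x - y).
(** Marks the points y too close to the sphere of radius r for the
    differentiation of the norm at r th - y, with |th| = 1, to be uniform. *)
Definition near_sphere (k : R) y : R := if `|enorm y - r| < k then 1 else 0.

Lemma enorm_unitdir_le1 x : enorm (unitdir x) <= 1.
Proof.
have [x0|x0] := eqVneq (enorm x) 0; last by rewrite enorm_unitdir.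
by rewrite /unitdir x0 invr0 enormZ normr0 mul0r.
Qed.

Lemma unitdirK x : enorm x *: unitdir x = x.
Proof.
have [x0|x0] := eqVneq (enorm x) 0; first by rewrite x0 scale0r (enorm_eq0 x0).
by rewrite scalerA mulfV// scale1r.
Qed.

Lemma collapseE x : collapse x = x + radial_gap x *: unitdir x.
Proof.
rewrite -[X in _ = X + _]unitdirK -scalerDl /collapse /radial_gap.
by case: ifP => _; rewrite ?addr0// addrC subrK.
Qed.

Lemma sqr_enorm_collapseB x : enorm (collapse x - x) ^+ 2 = radial_gap x ^+ 2.
Proof.
rewrite collapseE addrC addKr enormZ exprMn real_normK ?num_real//.
rewrite /radial_gap /in_shell; case: ifPn => [/andP[rx _]|_]; last by rewrite expr0n mul0r.
by rewrite enorm_unitdir ?expr1n ?mulr1// gt_eqF// (lt_le_trans r0).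
Qed.

Lemma enorm_gap_le x : enorm (radial_gap x *: unitdir x) <= `|radial_gap x|.
Proof. by rewrite enormZ ler_piMr// enorm_unitdir_le1. Qed.

Lemma sin2_at_itv x y : 0 <= sin2_at x y <= 1.
Proof. by apply: sin2_itv; exact: enorm_unitdir_le1. Qed.

Lemma pair_cost_ge0 x y : 0 <= pair_cost x y.
Proof. exact: excess_ge0. Qed.

Lemma pair_cost_le x y :
  pair_cost x y <= radial_gap x ^+ 2 + radial_gap y ^+ 2.
Proof.
apply: (le_trans (excess_le _ _)).
have -> : collapse x - collapse y - (x - y) =
    radial_gap x *: unitdir x + - (radial_gap y *: unitdir y).
  rewrite !collapseE; set X := _ *: _; set Y := _ *: _.
  by apply/rowP => i; rewrite !mxE; ring.
have h : enorm (radial_gap x *: unitdir x + - (radial_gap y *: unitdir y)) <=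
    `|radial_gap x| + `|radial_gap y|.
  apply: (le_trans (ler_enormD _ _)); rewrite enormN.
  by rewrite lerD// enorm_gap_le.
rewrite -(real_normK (num_real (radial_gap x))) -(real_normK (num_real (radial_gap y))).
set E := enorm _ in h *; have E0 : 0 <= E by exact: enorm_ge0.
have := normr_ge0 (radial_gap x); have := normr_ge0 (radial_gap y).
move: h; set a := `|_|; set b := `|_| => h b0 a0.
have : E ^+ 2 <= (a + b) ^+ 2 by rewrite ler_sqr ?nnegrE ?addr_ge0.
have := sqr_ge0 (a - b); lra.
Qed.

Lemma pair_costC x y : pair_cost x y = pair_cost y x.
Proof.
rewrite /pair_cost /excess -(opprB y x) -(opprB (collapse y)) !enormN.
by rewrite dotpNl dotpNr opprK.
Qed.

(** If y is at distance at least k from the sphere of radius r, [radial_core]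
    applies to a0 = r th - y, whose norm is at least k.  Otherwise both terms
    lie between 0 and half the squared gap. *)
Lemma pair_cost_one_side k x y : 0 < k -> 2 * (r' - r) <= k ->
  in_shell x -> ~~ in_shell y ->
  `|pair_cost x y - radial_gap x ^+ 2 * sin2_at x y / 2| <=
    radial_gap x ^+ 2 * (near_sphere k y + 4 * (r' - r) / k).
Proof.
move=> k0 ek xS yS.
have gy : radial_gap y = 0 by rewrite /radial_gap (negbTE yS).
have cy : collapse y = y by rewrite collapseE gy scale0r addr0.
move: (xS) => /andP[rx xr'].
have th1 : enorm (unitdir x) = 1 by rewrite enorm_unitdir// gt_eqF// (lt_le_trans r0).
have gx : radial_gap x = rb - enorm x by rewrite /radial_gap xS.
have eps0 : 0 <= 4 * (r' - r) / k by rewrite divr_ge0 ?mulr_ge0 ?subr_ge0 ?ltW.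
set th := unitdir x in th1 *; set a0 := r *: th - y.
have aE : x - y = a0 + (enorm x - r) *: th.
  by rewrite /a0 scalerBl (unitdirK x) addrAC addrCA subrr addr0 addrC.
have bE : collapse x - y = a0 + (rb - r) *: th.
  rewrite /a0 /collapse xS -/th scalerBl.
  by rewrite addrAC addrCA subrr addr0 addrC.
have cE : collapse x - y - (x - y) = radial_gap x *: th.
  by rewrite collapseE opprB addrA subrK addrAC subrr add0r.
have Q1 : pair_cost x y <= radial_gap x ^+ 2 / 2.
  rewrite /pair_cost cy; apply: (le_trans (excess_le _ _)).
  by rewrite cE enormZ th1 mulr1 real_normK ?num_real.
have /andP[s0 s1] := sin2_at_itv x y.
have g0 := sqr_ge0 (radial_gap x).
have [yk|ky] := ltP `|enorm y - r| k.
  rewrite /near_sphere yk; have Q0 := pair_cost_ge0 x y.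
  apply: (@le_trans _ _ (radial_gap x ^+ 2)); last by rewrite ler_peMr// lerDl.
  by rewrite ler_norml; apply/andP; split; nra.
rewrite /near_sphere ltNge ky/= add0r.
have A0k : k <= enorm a0.
  apply: (le_trans ky); have := ler_enorm_dist (r *: th) y.
  by rewrite enormZ th1 mulr1 (gtr0_norm r0) distrC.
have sq (al : R) : enorm (a0 + al *: th) ^+ 2 =
    enorm a0 ^+ 2 + 2 * al * dotp th a0 + al ^+ 2.
  exact: sqr_enorm_along.
have cs (al : R) : `|dotp th a0 + al| <= enorm (a0 + al *: th).
  have -> : dotp th a0 + al = dotp th (a0 + al *: th).
    by rewrite (dotpDr a0) dotpZr -sqr_enorm th1 expr1n mulr1.
  by apply: (le_trans (normr_dotp_enorm _ _)); rewrite th1 mul1r.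
have ds (al : R) : 0 <= al -> `|enorm (a0 + al *: th) - enorm a0| <= al.
  move=> al0; apply: (le_trans (ler_enorm_dist _ _)).
  by rewrite addrAC subrr add0r enormZ th1 mulr1 ger0_norm.
have cs0 : `|dotp th a0| <= enorm a0.
  by apply: (le_trans (normr_dotp_enorm _ _)); rewrite th1 mul1r.
have al0 : 0 <= enorm x - r <= r' - r by rewrite subr_ge0 rx lerB.
have be0 : 0 <= rb - r <= r' - r by case/andP: rbin => h1 h2; rewrite subr_ge0 h1 lerB.
have gE : rb - r - (enorm x - r) = radial_gap x by rewrite gx; ring.
have /andP[al1 _] := al0; have /andP[be1 _] := be0.
have := @radial_core R (enorm a0) (enorm (x - y)) (enorm (collapse x - y))
  (dotp th a0) (enorm x - r) (rb - r) (r' - r) k k0 ek A0k al0 be0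
  (enorm_ge0 _) (enorm_ge0 _).
rewrite gE aE bE !sq; move=> /(_ erefl erefl cs0 (cs _) (cs _) (ds _ al1) (ds _ be1)).
by rewrite -aE -bE /pair_cost cy excessE cE enormZ th1 mulr1 real_normK ?num_real//
  /sin2_at /sin2 -/th th1 expr1n.
Qed.

(** If both points are in the shell, both are near the sphere, and then the
    crude bound [pair_cost_le] suffices. *)
Lemma pair_cost_bound k x y : 0 < k -> 2 * (r' - r) <= k ->
  `|pair_cost x y -
     (radial_gap x ^+ 2 * sin2_at x y + radial_gap y ^+ 2 * sin2_at y x) / 2| <=
   radial_gap x ^+ 2 * (near_sphere k y + 4 * (r' - r) / k) +
   radial_gap y ^+ 2 * (near_sphere k x + 4 * (r' - r) / k).
Proof.
move=> k0 ek.
have gap0 z : ~~ in_shell z -> radial_gap z = 0 by rewrite /radial_gap => /negbTE ->.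
have sq0 : 0 ^+ 2 = 0 :> R by rewrite expr0n.
case: (boolP (in_shell x)) => xS; case: (boolP (in_shell y)) => yS; last 1 first.
- have := pair_cost_le x y; have := pair_cost_ge0 x y.
  rewrite !gap0// !sq0 !mul0r !addr0 => h1 h2.
  have -> : pair_cost x y = 0 by apply/eqP; rewrite eq_le h1 h2.
  by rewrite mul0r subr0 normr0.
- have eps0 : 0 <= 4 * (r' - r) / k by rewrite divr_ge0 ?mulr_ge0 ?subr_ge0 ?ltW.
  have near z : in_shell z -> near_sphere k z = 1.
    move=> /andP[rz zr]; rewrite /near_sphere ifT// ger0_norm ?subr_ge0//.
    by move: rr' ek; lra.
  rewrite !near//.
  have := pair_cost_le x y; have := pair_cost_ge0 x y.
  have /andP[s1 s2] := sin2_at_itv x y; have /andP[s3 s4] := sin2_at_itv y x.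
  have := sqr_ge0 (radial_gap x); have := sqr_ge0 (radial_gap y).
  set a := radial_gap x ^+ 2; set b := radial_gap y ^+ 2; move=> b0 a0 Q0 Q1.
  have h1 : a * sin2_at x y <= a by rewrite ler_piMr.
  have h2 : b * sin2_at y x <= b by rewrite ler_piMr.
  have h3 : 0 <= a * sin2_at x y by rewrite mulr_ge0.
  have h4 : 0 <= b * sin2_at y x by rewrite mulr_ge0.
  have h5 : 0 <= a * (4 * (r' - r) / k) by rewrite mulr_ge0.
  have h6 : 0 <= b * (4 * (r' - r) / k) by rewrite mulr_ge0.
  set e := 4 * (r' - r) / k in h5 h6 *; rewrite (mulrDr a 1 e) (mulrDr b 1 e) !mulr1.
  by rewrite ler_norml; apply/andP; split; lra.
- rewrite (gap0 y)// sq0 !mul0r !addr0.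
  exact: pair_cost_one_side.
- rewrite (gap0 x)// sq0 !mul0r !add0r pair_costC.
  exact: pair_cost_one_side.
Qed.

End collapse.

(** * The limiting squared sine *)

Section sin2_at_estimates.
Context (R : realType) (n : nat) (r : R).
Hypothesis r0 : 0 < r.
Implicit Types (x y : 'rV[R]_n).

Lemma unitdirZ (t : R) x : 0 < t -> unitdir (t *: x) = unitdir x.
Proof.
move=> t0; rewrite /unitdir enormZ gtr0_norm// scalerA invfM -mulrA mulrCA.
by rewrite mulVf ?mulr1// gt_eqF.
Qed.

Lemma unitdir_dich x : unitdir x = 0 \/ enorm (unitdir x) = 1.
Proof.
have [x0|x0] := eqVneq (enorm x) 0; last by right; exact: enorm_unitdir.
by left; rewrite /unitdir x0 invr0 scale0r.
Qed.

(** Adding a multiple of th to a does not change |a|^2 - (th.a)^2, which for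
    a = r th - y is therefore at most |y|^2, while |a| is at least r - K. *)
Lemma sin2_at_le (K : R) x y : enorm y <= K -> K < r ->
  sin2_at r x y <= (K / (r - K)) ^+ 2.
Proof.
move=> yK Kr; rewrite /sin2_at /sin2.
move: (unitdir x) (unitdir_dich x) => th [->|th1].
  apply: (@le_trans _ _ 0); last exact: sqr_ge0.
  rewrite -(scale0r (0 : 'rV[R]_n)) enormZ normr0 mul0r expr0n/= sub0r oppr_le0.
  exact: sqr_ge0.
have rK : 0 < r - K by rewrite subr_gt0.
have K0 : 0 <= K by apply: le_trans yK; exact: enorm_ge0.
have aK : r - K <= enorm (r *: th - y).
  have := ler_enorm_dist (r *: th) y.
  rewrite enormZ th1 mulr1 (gtr0_norm r0) ler_norml => /andP[_ h].
  by lra.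
have a0 : 0 < enorm (r *: th - y) by exact: lt_le_trans aK.
have -> : enorm th ^+ 2 - (dotp th (r *: th - y) / enorm (r *: th - y)) ^+ 2 =
    (enorm y ^+ 2 - dotp th y ^+ 2) / enorm (r *: th - y) ^+ 2.
  apply: (mulIf (lt0r_neq0 (exprn_gt0 2 a0))).
  rewrite mulrBl -[X in _ - X]exprMn (divfK (lt0r_neq0 a0))
    (divfK (lt0r_neq0 (exprn_gt0 2 a0))).
  by rewrite th1 (sqr_enorm (_ - _)) !dotpE -!sqr_enorm th1 (dotpC y th); ring.
rewrite expr_div_n ler_pM ?invr_ge0 ?sqr_ge0//.
- rewrite subr_ge0 -(real_normK (num_real (dotp th y))).
  rewrite ler_sqr ?nnegrE ?enorm_ge0//.
  by have := normr_dotp_enorm th y; rewrite th1 mul1r.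
- apply: (@le_trans _ _ (enorm y ^+ 2)); first by rewrite gerBl sqr_ge0.
  by rewrite ler_sqr ?nnegrE ?enorm_ge0.
- rewrite lef_pV2 ?posrE ?exprn_gt0// ler_sqr ?nnegrE ?(ltW rK)//.
  exact: enorm_ge0.
Qed.

(** If the sine vanished, y would be a multiple of x, which the signs of the
    coordinates exclude. *)
Lemma sin2_at_gt0 x y (i j : 'I_n) : 0 < x ord0 i -> 0 < x ord0 j ->
  0 < y ord0 i -> y ord0 j < 0 -> 0 < sin2_at r x y.
Proof.
move=> xi xj yi yj.
have x0 : enorm x != 0.
  by apply/eqP => /enorm_eq0 x0; move: xi; rewrite x0 mxE ltxx.
have th1 : enorm (unitdir x) = 1 by exact: enorm_unitdir.
have xp : 0 < enorm x by rewrite lt_neqAle eq_sym x0 enorm_ge0.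
have := sin2_at_itv r x y; rewrite le_eqVlt => /andP[/orP[|//]] /eqP + _.
rewrite /sin2_at; set th := unitdir x in th1 *; set a := r *: th - y.
rewrite /sin2 th1 expr1n => /esym /eqP; rewrite subr_eq0 => /eqP h.
have a0 : enorm a != 0.
  apply/eqP => a0; move: h; rewrite a0 invr0 mulr0 expr0n/= => /eqP.
  by rewrite oner_eq0.
pose q := dotp th a.
have q2 : q ^+ 2 = enorm a ^+ 2.
  by move: h; rewrite expr_div_n -/q => /esym /divr1_eq.
have aq : enorm (a + (- q) *: th) = 0.
  apply/eqP; rewrite -sqrf_eq0 sqr_enorm_along// -/q -q2.
  by apply/eqP; ring.
have aE : a = q *: th.
  by move/enorm_eq0/eqP: aq; rewrite scaleNr subr_eq0 => /eqP.
have yE l : y ord0 l = (r - q) / enorm x * x ord0 l.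
  have : y = (r - q) *: th by rewrite scalerBl -aE /a opprB addrCA subrr addr0.
  by move=> ->; rewrite /th !mxE; ring.
have h1 : 0 < (r - q) / enorm x by move: yi; rewrite yE pmulr_lgt0.
by move: yj; rewrite yE pmulr_rlt0// ltNge (ltW xj).
Qed.

End sin2_at_estimates.

(** * The Gaussian mass of shells *)

Section shells.
Context (R : realType) (s : R) (n : nat).
Hypothesis s0 : 0 < s.
Variable mu : {measure set (n.-tuple R) -> \bar R}.
Hypothesis muE : forall B : 'I_n -> set R, (forall i, measurable (B i)) ->
  mu [set u | forall i, B i (tnth u i)] = (\prod_(i < n) normal_prob 0 s (B i))%E.

Local Notation lam := (flat_measure s mu).
Local Notation nrm := (fun u : n.-tuple R => enorm (vec u)).
Local Notation menorm := (@measurable_enorm_vec R n).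

Lemma measurable_enorm_itv (I : interval R) :
  measurable [set u : n.-tuple R | enorm (vec u) \in I].
Proof.
rewrite -[X in measurable X]setTI.
exact: (menorm measurableT (measurable_itv I)).
Qed.

Lemma le_flat A : measurable A -> (mu A <= lam A)%E.
Proof.
move=> mA; rewrite /flat_measure /density_measure.
have -> : mu A = (\int[mu]_(u in A) 1%E)%E by rewrite integral_cst// mul1e.
apply: ge0_le_integral => //.
- by apply/measurable_EFinP/measurable_funTS; exact: measurable_gauss_weight.
- by move=> u _; rewrite lee_fin gauss_weight_ge1.
Qed.

Lemma flat_null A : measurable A -> mu A = 0%E -> lam A = 0%E.
Proof.
move=> mA A0; rewrite /flat_measure /density_measure.
apply: null_set_integral => //.
by apply/measurable_EFinP/measurable_funTS; exact: measurable_gauss_weight.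
Qed.

Lemma flat_annulus (a b : R) : 0 < a -> a <= b ->
  lam [set u | enorm (vec u) \in `[a, b[] =
  ((b ^+ n - a ^+ n) * fine (lam (@oball R n 1)))%:E.
Proof.
move=> a0 ab; have b0 := lt_le_trans a0 ab.
have fin t : lam (@oball R n t) \is a fin_num.
  by rewrite ge0_fin_numE// (flat_oball_fin s0 muE).
have mann := measurable_enorm_itv `[a, b[.
have : lam (@oball R n b) = (lam (@oball R n a) + lam [set u | enorm (vec u) \in `[a, b[])%E.
  rewrite -measureU//; [|exact: measurable_oball|].
    congr (lam _); apply/seteqP; split => u; rewrite /oball/= in_itv/=.
      by move=> ->; rewrite andbT; case: (ltP (enorm (vec u)) a); [left|right].
    by move=> [h|/andP[]//]; exact: lt_le_trans ab.
  apply/seteqP; split => u //; rewrite /oball/= in_itv/= => -[h /andP[h' _]].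
  by move: (lt_le_trans h h'); rewrite ltxx.
rewrite (flat_oball s0 muE a0) (flat_oball s0 muE b0).
rewrite -[lam (oball 1)](fineK (fin 1)) -!EFinM => h.
rewrite mulrBl EFinB h addeAC subee// add0e//.
Qed.

(** The half-open shell has positive volume, and sets that are null for the
    Gaussian law have volume 0. *)
Lemma shell_gt0 (a b : R) : (0 < n)%N -> 0 < a -> a < b ->
  (0 < mu [set u | enorm (vec u) \in `[a, b]])%E.
Proof.
move=> n0 a0 ab; rewrite lt0e measure_ge0 andbT; apply/eqP => mu0.
have m1 := measurable_enorm_itv `[a, b]; have m2 := measurable_enorm_itv `[a, b[.
have : (lam [set u | enorm (vec u) \in `[a, b[] <= 0)%E.
  rewrite -(flat_null m1 mu0); apply: le_measure; rewrite ?inE//.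
  by move=> u /=; rewrite !in_itv/= => /andP[-> /ltW].
rewrite flat_annulus ?(ltW ab)// lee_fin leNgt => /negP; apply.
have b0 := lt_trans a0 ab.
have abn : a ^+ n < b ^+ n by rewrite ltr_pXn2r// nnegrE ltW.
rewrite mulr_gt0 ?subr_gt0//.
by rewrite fine_gt0// flat_oball1_gt0//= (flat_oball_fin s0 muE).
Qed.

(** The volume dominates the Gaussian mass, and the volume of the shell between
    the radii r - k and r + k is continuous in k and vanishes at k = 0. *)
Lemma near_sphere_small (r e : R) : 0 < r -> 0 < e ->
  exists2 k, 0 < k & (mu [set u : n.-tuple R | `|enorm (vec u) - r| < k]%R <= e%:E)%E.
Proof.
move=> r0 e0; set c := fine (lam (@oball R n 1)).
have pow (g : R -> R) : g k @[k --> (0:R)] --> g 0 ->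
    g k ^+ n @[k --> (0:R)] --> g 0 ^+ n.
  move=> cg; exact: (@continuous_cvg _ _ _ _ _ g (fun x => x ^+ n) _
    (@exprn_continuous R n _) cg).
have : ((r + k) ^+ n - (r - k) ^+ n) * c @[k --> (0:R)^'+] -->
    ((r + 0) ^+ n - (r - 0) ^+ n) * c.
  apply: cvg_at_right_filter; apply: cvgM; last exact: cvg_cst.
  apply: cvgB.
    by apply: (pow (fun k => r + k)); apply: cvgD; [exact: cvg_cst|exact: cvg_id].
  by apply: (pow (fun k => r - k)); apply: cvgB; [exact: cvg_cst|exact: cvg_id].
rewrite addr0 subr0 subrr mul0r => /cvgr_lt /(_ _ e0) H.
have [k [kr k0 ke]] : exists k, [/\ k < r, 0 < k & ((r + k) ^+ n - (r - k) ^+ n) * c < e].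
  near (0:R)^'+ => k; exists k; split; near: k => //.
  - exact: nbhs_right_lt.
  - exact: nbhs_right_gt.
exists k => //.
apply: (@le_trans _ _ (lam [set u | enorm (vec u) \in `[r - k, r + k[])); last first.
  rewrite flat_annulus ?subr_gt0//; last by lra.
  by rewrite lee_fin ltW.
have m2 := measurable_enorm_itv `[r - k, r + k[.
apply: (le_trans _ (le_flat m2)); apply: le_measure; rewrite ?inE//.
  rewrite (_ : [set _ | _] = [set u | enorm (vec u) \in `]r - k, r + k[]).
    exact: measurable_enorm_itv.
  by apply/seteqP; split => u /=; rewrite in_itv/= ltr_distl.
by move=> u /=; rewrite in_itv/= ltr_distl => /andP[/ltW -> ->].
Unshelve. all: by end_near. Qed.

Lemma tail_small (e : R) : 0 < e ->
  exists2 K, 0 < K & (mu [set u : n.-tuple R | K <= enorm (vec u)]%R <= e%:E)%E.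
Proof.
move=> e0.
have cup : \bigcup_k @oball R n k%:R = [set: n.-tuple R].
  apply/seteqP; split => // u _; exists (Num.truncn (enorm (vec u))).+1 => //.
  by rewrite /oball/= truncnS_gt.
have := @nondecreasing_cvg_mu _ _ _ mu (fun k => @oball R n k%:R).
rewrite cup => /(_ (fun k => measurable_oball k%:R) measurableT).
move=> /(_ _)/wrap[].
  apply/nondecreasing_seqP => k; apply/subsetPset => u; rewrite /oball/= => h.
  by apply: (lt_le_trans h); rewrite ler_nat.
rewrite (product_law_setT muE) => cvg1.
have fin A : measurable A -> mu A \is a fin_num.
  move=> mA; rewrite ge0_fin_numE// (@le_lt_trans _ _ 1%E) ?ltry//.
  by rewrite -(product_law_setT muE) le_measure ?inE.
have mo k := @measurable_oball R n k.
have /fine_cvgP[_] : (mu \o (fun k : nat => @oball R n k%:R)) @ \oo --> 1%:E by [].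
move=> /cvgr_gt/(_ (1 - e)); rewrite ltrBlDr ltrDl => /(_ e0) [N _ HN].
exists N.+1%:R => //.
have mT : measurable [set u : n.-tuple R | N.+1%:R <= enorm (vec u)]%R.
  rewrite (_ : [set _ | _] = ~` @oball R n N.+1%:R); first exact: measurableC.
  by apply/seteqP; split => u; rewrite /oball/= leNgt => /negP.
have : (mu (@oball R n N.+1%:R) + mu [set u : n.-tuple R | N.+1%:R <= enorm (vec u)]%R = 1)%E.
  rewrite -measureU//.
    rewrite -(product_law_setT muE); congr (mu _).
    by apply/seteqP; split => // u _; case: (ltP (enorm (vec u)) N.+1%:R); [left|right].
  by apply/seteqP; split => u //; rewrite /oball/= => -[/lt_le_trans h /h]; rewrite ltxx.
have := HN N.+1 (leqnSn N); rewrite /=.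
move=> h /(congr1 fine); rewrite fineD ?fin// [fine 1]/= => h'.
rewrite -(fineK (fin _ mT)) lee_fin. lra.
Qed.

End shells.

(** * Measurability of vector expressions *)

Section measurable_vectors.
Context d (Z : measurableType d) (R : realType) (n : nat).
Implicit Types (x y : Z -> 'rV[R]_n) (c : Z -> R).

(** Read on coordinates, since the sigma-algebra is that of tuples while the
    linear operations are those of row vectors. *)
Definition measurable_vector x :=
  forall i, measurable_fun setT (fun z => x z ord0 i).

Lemma measurable_vec (u : Z -> n.-tuple R) :
  measurable_fun setT u -> measurable_vector (fun z => vec (u z)).
Proof.
move=> mu i; under eq_fun do rewrite mxE.
by move/measurable_fun_tnthP : mu; exact.
Qed.

Lemma measurable_vectorB x y : measurable_vector x -> measurable_vector y ->
  measurable_vector (fun z => x z - y z).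
Proof.
by move=> mx my i; under eq_fun do rewrite !mxE; exact: measurable_funB.
Qed.

Lemma measurable_vectorZ c x : measurable_fun setT c -> measurable_vector x ->
  measurable_vector (fun z => c z *: x z).
Proof.
by move=> mc mx i; under eq_fun do rewrite !mxE; exact: measurable_funM.
Qed.

Lemma measurable_dotp x y : measurable_vector x -> measurable_vector y ->
  measurable_fun setT (fun z => dotp (x z) (y z)).
Proof.
by move=> mx my; apply: measurable_sum => i; exact: measurable_funM.
Qed.

Lemma measurable_enorm x : measurable_vector x ->
  measurable_fun setT (fun z => enorm (x z)).
Proof.
move=> mx; apply: measurableT_comp; last exact: measurable_dotp.
by apply: continuous_measurable_fun; exact: sqrt_continuous.
Qed.

Lemma measurable_inv_enorm x : measurable_vector x ->
  measurable_fun setT (fun z => (enorm (x z))^-1).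
Proof.
move=> mx.
(* the power function with exponent -1 agrees with the inverse also at 0 *)
under eq_fun do rewrite -(powR_inv1 (enorm_ge0 _)).
apply: (@measurableT_comp _ _ _ _ _ _ (fun a : R => a `^ (-1))).
  exact: measurable_powR.
exact: measurable_enorm.
Qed.

Lemma measurable_unitdir x : measurable_vector x ->
  measurable_vector (fun z => unitdir (x z)).
Proof.
by move=> mx; apply: measurable_vectorZ => //; exact: measurable_inv_enorm.
Qed.

Lemma measurable_excess x y : measurable_vector x -> measurable_vector y ->
  measurable_fun setT (fun z => excess (x z) (y z)).
Proof.
move=> mx my; apply: measurable_funB; last exact: measurable_dotp.
by apply: measurable_funM; exact: measurable_enorm.
Qed.

Lemma measurable_sin2_at r x y : measurable_vector x -> measurable_vector y ->
  measurable_fun setT (fun z => sin2_at r (x z) (y z)).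
Proof.
move=> mx my; have mu := measurable_unitdir mx.
have ma : measurable_vector (fun z => r *: unitdir (x z) - y z).
  by apply: measurable_vectorB => //; apply: measurable_vectorZ.
apply: measurable_funB; apply: measurable_funX; first exact: measurable_enorm.
apply: measurable_funM; first exact: measurable_dotp.
exact: measurable_inv_enorm.
Qed.

Lemma measurable_in_shell r r' x : measurable_vector x ->
  measurable_fun setT (fun z => in_shell r r' (x z)).
Proof.
move=> /measurable_enorm mx.
by apply: measurable_and; apply: measurable_fun_ler.
Qed.

Lemma measurable_radial_gap r r' rb x : measurable_vector x ->
  measurable_fun setT (fun z => radial_gap r r' rb (x z)).
Proof.
move=> mx; apply: measurable_fun_ifT => //; first exact: measurable_in_shell.
by apply: measurable_funB => //; exact: measurable_enorm.
Qed.

Lemma measurable_collapse r r' rb x : measurable_vector x ->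
  measurable_vector (fun z => collapse r r' rb (x z)).
Proof.
move=> mx; apply: measurable_vectorZ; last exact: measurable_unitdir.
apply: measurable_fun_ifT => //; first exact: measurable_in_shell.
exact: measurable_enorm.
Qed.

Lemma measurable_pair_cost r r' rb x y :
  measurable_vector x -> measurable_vector y ->
  measurable_fun setT (fun z => pair_cost r r' rb (x z) (y z)).
Proof.
move=> mx my; apply: measurable_excess; apply: measurable_vectorB => //;
  exact: measurable_collapse.
Qed.

Lemma measurable_near_sphere r k x : measurable_vector x ->
  measurable_fun setT (fun z => near_sphere r k (x z)).
Proof.
move=> mx; apply: measurable_fun_ifT => //.
apply: measurable_fun_ltr => //; apply: measurableT_comp => //.
by apply: measurable_funB => //; exact: measurable_enorm.
Qed.

End measurable_vectors.

(** * Averages over independent pairs *)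

Lemma ge0_integral_prod (R : realType) d1 d2 (X : measurableType d1) (Y : measurableType d2)
    (m1 : {sigma_finite_measure set X -> \bar R})
    (m2 : {sigma_finite_measure set Y -> \bar R}) (g : X -> R) (h : Y -> R) :
  measurable_fun setT g -> measurable_fun setT h ->
  (forall x, 0 <= g x) -> (forall y, 0 <= h y) ->
  (\int[m1 \x m2]_z (g z.1 * h z.2)%:E =
   (\int[m1]_x (g x)%:E) * (\int[m2]_y (h y)%:E))%E.
Proof.
move=> mg mh g0 h0; rewrite fubini_tonelli1; last 2 first.
- apply/measurable_EFinP/measurable_funM.
    exact: (measurableT_comp mg measurable_fst).
  exact: (measurableT_comp mh measurable_snd).
- by move=> z; rewrite lee_fin mulr_ge0.
rewrite /fubini_F -ge0_integralZr//; last 3 first.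
- exact/measurable_EFinP.
- by move=> x _; rewrite lee_fin.
- by apply: integral_ge0 => y _; rewrite lee_fin.
apply: eq_integral => x _; rewrite -ge0_integralZl//=.
- exact/measurable_EFinP.
- by move=> y _; rewrite lee_fin.
- by rewrite lee_fin.
Qed.

Lemma ge0_integral_prodC (R : realType) d (X : measurableType d)
    (m : {sigma_finite_measure set X -> \bar R}) (f : X * X -> \bar R) :
  measurable_fun setT f -> (forall z, 0 <= f z)%E ->
  (\int[m \x m]_z f (z.2, z.1) = \int[m \x m]_z f z)%E.
Proof.
move=> mf f0; rewrite fubini_tonelli2//; first by rewrite fubini_tonelli1.
by apply: (measurableT_comp mf); exact: measurable_fun_pair.
Qed.

Section pair_integrals.
Context (R : realType) (s : R) (n : nat).
Hypothesis s0 : 0 < s.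
Variable mu : probability (n.-tuple R) R.
Hypothesis muE : forall B : 'I_n -> set R, (forall i, measurable (B i)) ->
  mu [set u | forall i, B i (tnth u i)] = (\prod_(i < n) normal_prob 0 s (B i))%E.

(** The three averages that the proof compares: sigma(r), E|V - U|^2 and the
    denominator of the cost ratio, expressed with the law mu of U. *)
Definition mean_sin2 (r : R) : \bar R :=
  (\int[mu \x mu]_z (sin2_at r (vec z.1) (vec z.2))%:E)%E.

Definition mean_gap2 (r r' rb : R) : \bar R :=
  (\int[mu]_u (radial_gap r r' rb (vec u) ^+ 2)%:E)%E.

Definition mean_cost (r r' rb : R) : \bar R :=
  (\int[mu \x mu]_z (pair_cost r r' rb (vec z.1) (vec z.2))%:E)%E.

Let mvec1 : measurable_vector (fun z : n.-tuple R * n.-tuple R => vec z.1).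
Proof. by apply: measurable_vec. Qed.
Let mvec2 : measurable_vector (fun z : n.-tuple R * n.-tuple R => vec z.2).
Proof. by apply: measurable_vec. Qed.
Let mvec : measurable_vector (fun u : n.-tuple R => vec u).
Proof. by apply: measurable_vec. Qed.

(** Averaging over the second point leaves a function of the direction of the
    first one, which is independent of its radius, hence of its gap. *)
Lemma mean_gap2_sin2 r r' rb :
  (\int[mu \x mu]_z (radial_gap r r' rb (vec z.1) ^+ 2 *
     sin2_at r (vec z.1) (vec z.2))%:E = mean_gap2 r r' rb * mean_sin2 r)%E.
Proof.
have msin := measurable_sin2_at r mvec1 mvec2.
have sin0 (x y : 'rV[R]_n) : 0 <= sin2_at r x y by case/andP: (sin2_at_itv r x y).
have sin1 (x y : 'rV[R]_n) : sin2_at r x y <= 1 by case/andP: (sin2_at_itv r x y).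
have mgap2 : measurable_fun setT (fun u : n.-tuple R => radial_gap r r' rb (vec u) ^+ 2).
  by apply: measurable_funX; exact: measurable_radial_gap.
pose F (u : n.-tuple R) := (\int[mu]_v (sin2_at r (vec u) (vec v))%:E)%E.
have msinu (u : n.-tuple R) :
    measurable_fun setT (fun v : n.-tuple R => sin2_at r (vec u) (vec v)).
  by apply: measurable_sin2_at => // i; exact: measurable_cst.
have F0 u : (0 <= F u)%E by apply: integral_ge0 => v _; rewrite lee_fin.
have F1 u : (F u <= 1)%E.
  rewrite -(@probability_setT _ _ _ mu) -[leRHS]mul1e -integral_cst//.
  apply: ge0_le_integral => //.
  - by move=> v _; rewrite lee_fin.
  - exact/measurable_EFinP.
  - by move=> v _; rewrite lee_fin.
have Ffin u : F u \is a fin_num.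
  by rewrite ge0_fin_numE// (le_lt_trans (F1 u))// ltry.
have mF : measurable_fun setT F.
  apply: (measurable_fun_fubini_tonelli_F (fun z : n.-tuple R * n.-tuple R =>
    (sin2_at r (vec z.1) (vec z.2))%:E)).
  - exact/measurable_EFinP.
  - by move=> z; rewrite lee_fin.
have F_hom t u : 0 < t -> F (tscale t u) = F u.
  move=> t0; apply: eq_integral => v _.
  by rewrite /sin2_at vec_tscale unitdirZ.
have mfF : measurable_fun setT (fine \o F).
  apply/measurable_EFinP; rewrite (_ : EFin \o _ = F)//.
  by apply/funext => u; rewrite /= fineK.
rewrite fubini_tonelli1; last 2 first.
- apply/measurable_EFinP; apply: measurable_funM => //.
  by apply: measurable_funX; exact: measurable_radial_gap.
- by move=> z; rewrite lee_fin mulr_ge0// sqr_ge0.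
transitivity (\int[mu]_u (radial_gap r r' rb (vec u) ^+ 2 * fine (F u))%:E)%E.
  apply: eq_integral => u _; rewrite /fubini_F EFinM fineK// -ge0_integralZl//.
  - exact/measurable_EFinP.
  - by move=> v _; rewrite lee_fin.
  - by rewrite lee_fin sqr_ge0.
have -> : mean_sin2 r = (\int[mu]_u (fine (F u))%:E)%E.
  rewrite /mean_sin2 fubini_tonelli1.
  - by apply: eq_integral => u _; rewrite fineK.
  - exact/measurable_EFinP.
  - by move=> z; rewrite lee_fin.
apply: (@radial_angular_indep R s n s0 mu muE (fine \o F)
  (fun a => (if r <= a <= r' then rb - a else 0) ^+ 2)).
- exact: mfF.
- by move=> u; exact: (fine_ge0 (F0 u)).
- by move=> u; rewrite -lee_fin /= (fineK (Ffin u)).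
- by move=> t u t0; exact: (congr1 fine (F_hom t u t0)).
- apply: measurable_funX; apply: measurable_fun_ifT => //.
  + by apply: measurable_and; apply: measurable_fun_ler.
  + by apply: measurable_funB.
- by move=> a; rewrite sqr_ge0.
Qed.

Section bounds.
Variables (r r' rb : R).
Hypotheses (r0 : 0 < r) (rr' : r < r') (rbin : r <= rb <= r').

Local Notation gap2 u := (radial_gap r r' rb (vec u) ^+ 2).

Lemma gap2_le (u : n.-tuple R) : gap2 u <= (r' - r) ^+ 2.
Proof.
rewrite /radial_gap /in_shell; case: ifPn => [/andP[h1 h2]|_]; last first.
  by rewrite expr0n sqr_ge0.
case/andP: rbin => h3 h4.
by rewrite -(real_normK (num_real (rb - _))) ler_sqr ?nnegrE ?subr_ge0 ?(ltW rr')//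
  ler_norml; apply/andP; split; lra.
Qed.

Let mgap2 : measurable_fun setT (fun u : n.-tuple R => gap2 u).
Proof. by apply: measurable_funX; exact: measurable_radial_gap. Qed.

Let mgap2E : measurable_fun setT (fun u : n.-tuple R => (gap2 u)%:E).
Proof. exact/measurable_EFinP. Qed.

Lemma mean_gap2_le : (mean_gap2 r r' rb <= ((r' - r) ^+ 2)%:E)%E.
Proof.
rewrite -[leRHS]mule1 -(@probability_setT _ _ _ mu) -integral_cst//.
apply: ge0_le_integral => //.
- by move=> u _; rewrite lee_fin sqr_ge0.
- by move=> u _; rewrite lee_fin gap2_le.
Qed.

Lemma mean_gap2_ge0 : (0 <= mean_gap2 r r' rb)%E.
Proof. by apply: integral_ge0 => u _; rewrite lee_fin sqr_ge0. Qed.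

Lemma mean_gap2_fin : mean_gap2 r r' rb \is a fin_num.
Proof.
by rewrite ge0_fin_numE ?mean_gap2_ge0// (le_lt_trans mean_gap2_le)// ltry.
Qed.

(** The gap is at least a quarter of the thickness on one of the two boundary
    quarters of the shell: on the inner one when rb is above the midpoint, on
    the outer one otherwise. *)
Lemma mean_gap2_gt0 : (0 < n)%N -> (0 < mean_gap2 r r' rb)%E.
Proof.
move=> n0; pose q := (r' - r) / 4.
have q0 : 0 < q by rewrite divr_gt0 ?subr_gt0.
have q4 : 4 * q = r' - r by rewrite /q mulrC divfK.
clearbody q.
have [a [b [a0 ab abP]]] : exists a b : R, [/\ 0 < a, a < b &
    forall x, a <= x <= b -> r <= x <= r' /\ q <= `|rb - x|].
  have [h|h] := leP (r + 2 * q) rb.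
    exists r, (r + q); split; [exact: r0|by rewrite ltrDl|].
    move=> x /andP[h1 h2]; split; first by apply/andP; split; lra.
    by rewrite ger0_norm; lra.
  exists (r' - q), r'; split; [by move: r0 rr' q4; lra|by rewrite gtrBl|].
  move=> x /andP[h1 h2]; split; first by apply/andP; split; lra.
  by rewrite ler0_norm; lra.
have mA := measurable_enorm_itv (n := n) `[a, b].
apply: (@lt_le_trans _ _ (\int[mu]_u (q ^+ 2 *
    \1_[set u : n.-tuple R | enorm (vec u) \in `[a, b]] u)%:E)%E).
  under eq_integral do rewrite EFinM.
  rewrite ge0_integralZl//; last 2 first.
  - by apply/measurable_EFinP; exact: measurable_indic.
  - by rewrite lee_fin sqr_ge0.
  rewrite integral_indic// setIT mule_gt0 ?lte_fin ?exprn_gt0//.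
  exact: (shell_gt0 s0 muE).
apply: ge0_le_integral => //.
- by move=> u _; rewrite lee_fin mulr_ge0 ?sqr_ge0.
- by apply/measurable_EFinP; apply: measurable_funM => //; exact: measurable_indic.
- move=> u _; rewrite lee_fin indicE.
  case: (boolP (u \in _)) => [/set_mem /= uab|_]; last by rewrite mulr0 sqr_ge0.
  have [h1 h2] : r <= enorm (vec u) <= r' /\ q <= `|rb - enorm (vec u)|.
    by apply: abP; move: uab; rewrite in_itv.
  rewrite mulr1 /radial_gap /in_shell h1 -(real_normK (num_real (rb - _))).
  by rewrite ler_sqr ?nnegrE// ltW.
Qed.

Lemma mean_sin2_ge0 : (0 <= mean_sin2 r)%E.
Proof.
apply: integral_ge0 => z _; rewrite lee_fin.
by case/andP: (sin2_at_itv r (vec z.1) (vec z.2)).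
Qed.

Lemma mean_cost_ge0 : (0 <= mean_cost r r' rb)%E.
Proof. by apply: integral_ge0 => z _; rewrite lee_fin pair_cost_ge0. Qed.

(** The average over y of the relative error in [pair_cost_bound]. *)
Definition shell_error (k : R) : \bar R :=
  (mu [set u : n.-tuple R | `|enorm (vec u) - r| < k]%R + (4 * (r' - r) / k)%:E)%E.

(** Integral of [pair_cost_bound].  Exchanging the two points shows that the
    two terms of each sum contribute equally.  Two inequalities between sums of
    nonnegative terms replace the absolute value, so that no difference of
    extended reals occurs. *)
Lemma mean_cost_bound_ereal k : 0 < k -> 2 * (r' - r) <= k ->
  (2%:E * mean_cost r r' rb <= 2%:E * (mean_gap2 r r' rb * mean_sin2 r) +
    4%:E * (mean_gap2 r r' rb * shell_error k))%E /\
  (2%:E * (mean_gap2 r r' rb * mean_sin2 r) <= 2%:E * mean_cost r r' rb +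
    4%:E * (mean_gap2 r r' rb * shell_error k))%E.
Proof.
move=> k0 ek; set c := 4 * (r' - r) / k.
have c0 : 0 <= c by rewrite divr_ge0 ?mulr_ge0 ?subr_ge0 ?ltW.
pose Z := (n.-tuple R * n.-tuple R)%type.
pose Q (z : Z) := pair_cost r r' rb (vec z.1) (vec z.2).
pose A (z : Z) := gap2 z.1 * sin2_at r (vec z.1) (vec z.2).
pose B (z : Z) := gap2 z.2 * sin2_at r (vec z.2) (vec z.1).
pose eta (u : n.-tuple R) := near_sphere r k (vec u) + c.
pose C (z : Z) := gap2 z.1 * eta z.2.
pose E (z : Z) := gap2 z.2 * eta z.1.
have near0 (u : n.-tuple R) : 0 <= near_sphere r k (vec u) by rewrite /near_sphere; case: ifP.
have eta0 u : 0 <= eta u by rewrite addr_ge0.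
have sin0 (x y : 'rV[R]_n) : 0 <= sin2_at r x y by case/andP: (sin2_at_itv r x y).
have meta : measurable_fun setT eta.
  by apply: measurable_funD => //; exact: measurable_near_sphere.
have mQ : measurable_fun setT (fun z => (Q z)%:E).
  by apply/measurable_EFinP; exact: measurable_pair_cost.
have mg1 : measurable_fun setT (fun z : Z => gap2 z.1).
  by apply: measurable_funX; exact: measurable_radial_gap.
have mg2 : measurable_fun setT (fun z : Z => gap2 z.2).
  by apply: measurable_funX; exact: measurable_radial_gap.
have mA : measurable_fun setT (fun z => (A z)%:E).
  by apply/measurable_EFinP; apply: measurable_funM => //; exact: measurable_sin2_at.
have mB : measurable_fun setT (fun z => (B z)%:E).
  by apply/measurable_EFinP; apply: measurable_funM => //; exact: measurable_sin2_at.
have mC : measurable_fun setT (fun z => (C z)%:E).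
  apply/measurable_EFinP; apply: measurable_funM => //.
  exact: (measurableT_comp meta measurable_snd).
have mE : measurable_fun setT (fun z => (E z)%:E).
  apply/measurable_EFinP; apply: measurable_funM => //.
  exact: (measurableT_comp meta measurable_fst).
have Q0 z : (0 <= (Q z)%:E)%E by rewrite lee_fin pair_cost_ge0.
have A0 z : (0 <= (A z)%:E)%E by rewrite lee_fin mulr_ge0// sqr_ge0.
have B0 z : (0 <= (B z)%:E)%E by rewrite lee_fin mulr_ge0// sqr_ge0.
have C0 z : (0 <= (C z)%:E)%E by rewrite lee_fin mulr_ge0// sqr_ge0.
have E0 z : (0 <= (E z)%:E)%E by rewrite lee_fin mulr_ge0// sqr_ge0.
have iQ : (\int[mu \x mu]_z (Q z)%:E)%E = mean_cost r r' rb by [].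
have iA : (\int[mu \x mu]_z (A z)%:E = mean_gap2 r r' rb * mean_sin2 r)%E.
  exact: mean_gap2_sin2.
have iB : (\int[mu \x mu]_z (B z)%:E = mean_gap2 r r' rb * mean_sin2 r)%E.
  by rewrite -iA -(ge0_integral_prodC mu mA A0).
have ieta : (\int[mu]_u (eta u)%:E = shell_error k)%E.
  under eq_integral do rewrite EFinD.
  rewrite ge0_integralD//; last 2 first.
  - by move=> u _; rewrite lee_fin.
  - by apply/measurable_EFinP; exact: measurable_near_sphere.
  rewrite integral_cst// [X in (_ * X)%E](@probability_setT _ _ _ mu) mule1; congr (_ + _)%E.
  set N := [set u : n.-tuple R | _].
  have mN : measurable N.
    rewrite (_ : N = [set u | enorm (vec u) \in `]r - k, r + k[]).
      exact: measurable_enorm_itv.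
    by apply/seteqP; split => u /=; rewrite /N in_itv/= ltr_distl.
  rewrite -[RHS]mul1e -[X in (X * _)%E]/(1%:E) -[in RHS](setIT N) -integral_indic//.
  rewrite mul1e; apply: eq_integral => u _; rewrite indicE /near_sphere.
  by case: (boolP (u \in N)) => [/set_mem ->//|/negP uN]; rewrite ifF//;
    apply/negP => h; apply: uN; exact/mem_set.
have iC : (\int[mu \x mu]_z (C z)%:E = mean_gap2 r r' rb * shell_error k)%E.
  rewrite -ieta; apply: (@ge0_integral_prod _ _ _ _ _ mu mu _ _ mgap2 meta) => // u.
  exact: sqr_ge0.
have iE : (\int[mu \x mu]_z (E z)%:E = mean_gap2 r r' rb * shell_error k)%E.
  by rewrite -iC -(ge0_integral_prodC mu mC C0).
have i2 (F G : Z -> R) : measurable_fun setT (fun z => (F z)%:E) ->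
    measurable_fun setT (fun z => (G z)%:E) ->
    (forall z, (0 <= (F z)%:E)%E) -> (forall z, (0 <= (G z)%:E)%E) ->
    (\int[mu \x mu]_z ((F z)%:E + (G z)%:E) =
     \int[mu \x mu]_z (F z)%:E + \int[mu \x mu]_z (G z)%:E)%E.
  by move=> mF mG F0 G0; rewrite ge0_integralD.
have iZ (F : Z -> R) (a : R) : measurable_fun setT (fun z => (F z)%:E) ->
    (forall z, (0 <= (F z)%:E)%E) -> 0 <= a ->
    (\int[mu \x mu]_z (a%:E * (F z)%:E) = a%:E * \int[mu \x mu]_z (F z)%:E)%E.
  by move=> mF F0 a0; rewrite ge0_integralZl// lee_fin.
have key (z : Z) := pair_cost_bound r0 rr' rbin (vec z.1) (vec z.2) k0 ek.
have two0 : 0 <= 2 :> R by [].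
have e1 : (2%:E * (mean_gap2 r r' rb * mean_sin2 r) =
    \int[mu \x mu]_z (A z + B z)%:E)%E.
  under eq_integral do rewrite EFinD.
  by rewrite i2// iA iB mule_natl mule2n.
have e2 : (4%:E * (mean_gap2 r r' rb * shell_error k) =
    \int[mu \x mu]_z (2 * (C z + E z))%:E)%E.
  under eq_integral do rewrite EFinM.
  have mCE : measurable_fun setT (fun z => (C z + E z)%:E).
    by under eq_fun do rewrite EFinD; exact: emeasurable_funD.
  rewrite iZ//; last by move=> z; rewrite EFinD adde_ge0.
  under eq_integral do rewrite EFinD.
  rewrite i2// iC iE -mule2n -mule_natl [in RHS]muleA -EFinM; congr (_%:E * _)%E.
  by rewrite -natrM.
have e3 : (2%:E * mean_cost r r' rb = \int[mu \x mu]_z (2 * Q z)%:E)%E.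
  by under eq_integral do rewrite EFinM; rewrite iZ.
have mS (F G : Z -> R) : measurable_fun setT (fun z => (F z)%:E) ->
    measurable_fun setT (fun z => (G z)%:E) ->
    measurable_fun setT (fun z => (F z + G z)%:E).
  by move=> mF mG; under eq_fun do rewrite EFinD; exact: emeasurable_funD.
have mZ (F : Z -> R) : measurable_fun setT (fun z => (F z)%:E) ->
    measurable_fun setT (fun z => (2 * F z)%:E).
  by move=> mF; under eq_fun do rewrite EFinM; exact: measurable_funeM.
have AB0 z : (0 <= (A z + B z)%:E)%E by rewrite EFinD adde_ge0.
have CE0 z : (0 <= (2 * (C z + E z))%:E)%E by rewrite lee_fin mulr_ge0// addr_ge0// -lee_fin.
have QQ0 z : (0 <= (2 * Q z)%:E)%E by rewrite lee_fin mulr_ge0// -lee_fin.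
have mAB := mS _ _ mA mB; have mCE := mZ _ (mS _ _ mC mE); have mQQ := mZ _ mQ.
rewrite e1 e2 e3 -!i2//; split; apply: ge0_le_integral => //;
  try by [move=> z _; rewrite adde_ge0 | exact: emeasurable_funD].
- move=> z _; rewrite -EFinD lee_fin; have := key z.
  rewrite ler_norml => /andP[h1 h2]; rewrite /Q /A /B /C /E /eta -/c in h1 h2 *; lra.
- move=> z _; rewrite -EFinD lee_fin; have := key z.
  rewrite ler_norml => /andP[h1 h2]; rewrite /Q /A /B /C /E /eta -/c in h1 h2 *; lra.
Qed.

End bounds.

End pair_integrals.

(** * Size of the mean squared sine *)

Section mean_values.
Context (R : realType) (s : R) (n : nat).
Hypothesis s0 : 0 < s.
Variable mu : probability (n.-tuple R) R.
Hypothesis muE : forall B : 'I_n -> set R, (forall i, measurable (B i)) ->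
  mu [set u | forall i, B i (tnth u i)] = (\prod_(i < n) normal_prob 0 s (B i))%E.

Local Notation mean_sin2 := (mean_sin2 mu).
Local Notation mean_gap2 := (mean_gap2 mu).
Local Notation mean_cost := (mean_cost mu).

Let mvec1 : measurable_vector (fun z : n.-tuple R * n.-tuple R => vec z.1).
Proof. by apply: measurable_vec. Qed.
Let mvec2 : measurable_vector (fun z : n.-tuple R * n.-tuple R => vec z.2).
Proof. by apply: measurable_vec. Qed.

Lemma sin2_at_ge0 r (x y : 'rV[R]_n) : 0 <= sin2_at r x y.
Proof. by case/andP: (sin2_at_itv r x y). Qed.

Lemma sin2_at_le1 r (x y : 'rV[R]_n) : sin2_at r x y <= 1.
Proof. by case/andP: (sin2_at_itv r x y). Qed.

Lemma measurable_mean_sin2 r : measurable_fun setT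
  (fun z : n.-tuple R * n.-tuple R => (sin2_at r (vec z.1) (vec z.2))%:E).
Proof. by apply/measurable_EFinP; exact: measurable_sin2_at. Qed.

(** Where |y| < K, [sin2_at_le] applies; elsewhere the squared sine is at most
    1. *)
Lemma mean_sin2_le_tail r K : 0 < r -> K < r ->
  (mean_sin2 r <= mu [set u : n.-tuple R | K <= enorm (vec u)]%R +
    ((K / (r - K)) ^+ 2)%:E)%E.
Proof.
move=> r0 Kr; set A := [set u : n.-tuple R | _]; set c := (K / (r - K)) ^+ 2.
have mA : measurable A.
  rewrite (_ : A = [set u : n.-tuple R | enorm (vec u) \in `[K, +oo[]).
    exact: measurable_enorm_itv.
  by apply/seteqP; split => u /=; rewrite /A in_itv/= andbT.
have m1A : measurable_fun setT (fun u : n.-tuple R => \1_A u + c).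
  by apply: measurable_funD => //; exact: measurable_indic.
have c0 : 0 <= c by exact: sqr_ge0.
have A0 (u : n.-tuple R) : 0 <= \1_A u + c by rewrite addr_ge0.
have -> : (mu A + c%:E = \int[mu \x mu]_z (1 * (\1_A z.2 + c))%:E)%E.
  rewrite (@ge0_integral_prod _ _ _ _ _ mu mu (fun=> 1) (fun u => \1_A u + c))//.
  rewrite integral_cst// [X in (_ * X * _)%E](@probability_setT _ _ _ mu) mule1 mul1e.
  under eq_integral do rewrite EFinD.
  rewrite ge0_integralD//; last by apply/measurable_EFinP; exact: measurable_indic.
  rewrite integral_indic// setIT integral_cst//.
  by rewrite [X in (_ * X)%E](@probability_setT _ _ _ mu) mule1.
apply: ge0_le_integral => //.
- by move=> z _; rewrite lee_fin sin2_at_ge0.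
- exact: measurable_mean_sin2.
- apply/measurable_EFinP; apply: measurable_funM => //.
  exact: (measurableT_comp m1A measurable_snd).
- move=> z _; rewrite lee_fin mul1r indicE; case: (boolP (z.2 \in A)) => [_|/negP zA].
    by rewrite (le_trans (sin2_at_le1 _ _ _))// lerDl.
  rewrite add0r; apply: sin2_at_le => //.
  by rewrite leNgt; apply/negP => /ltW h; apply: zA; exact/mem_set.
Qed.

Lemma mean_sin2_fin r : mean_sin2 r \is a fin_num.
Proof.
rewrite ge0_fin_numE ?mean_sin2_ge0//.
apply: (@le_lt_trans _ _ (\int[mu \x mu]_z (1 * 1)%:E)%E).
  apply: ge0_le_integral => //.
  - by move=> z _; rewrite lee_fin sin2_at_ge0.
  - exact: measurable_mean_sin2.
  - by move=> z _; rewrite lee_fin mul1r sin2_at_le1.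
rewrite (@ge0_integral_prod _ _ _ _ _ mu mu (fun=> 1) (fun=> 1))//.
rewrite integral_cst// !mul1e.
by rewrite [X in (X * X)%E](@probability_setT _ _ _ mu) mule1 ltry.
Qed.

Lemma mean_sin2_small e : 0 < e ->
  exists r1, forall r, r1 < r -> (mean_sin2 r <= e%:E)%E.
Proof.
move=> e0; have e20 : 0 < e / 2 by rewrite divr_gt0.
have [K K0 HK] := tail_small muE e20.
pose b := Num.min 1 (e / 2); have b0 : 0 < b by rewrite lt_min ltr01.
(* r - K > K / b gives K / (r - K) < b <= 1, whose square is at most e / 2 *)
exists (K + K / b) => r Kr.
have Kb0 : 0 < K / b by rewrite divr_gt0.
have rK : K / b < r - K by rewrite ltrBrDl.
have rK0 : 0 < r - K by exact: lt_trans rK.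
have Kr' : K < r by rewrite -subr_gt0.
apply: (le_trans (mean_sin2_le_tail (lt_trans K0 Kr') Kr')).
rewrite [X in (_ <= X%:E)%E](splitr e) EFinD leeD// lee_fin.
have qb : K / (r - K) <= b by rewrite ler_pdivrMr// mulrC -ler_pdivrMr// ltW.
have q0 : 0 <= K / (r - K) by apply: divr_ge0; exact: ltW.
have b1 : b <= 1 by rewrite ge_min lexx.
apply: (@le_trans _ _ b); last by rewrite ge_min lexx orbT.
by apply: (le_trans _ qb); rewrite expr2 ler_piMr// (le_trans qb b1).
Qed.

Lemma box_gt0 (a b : 'I_n -> R) : (forall i, a i < b i) -> (0 < mu (box a b))%E.
Proof.
move=> ab; rewrite lt0e measure_ge0 andbT; apply/eqP => mu0.
have := flat_null s (measurable_box a b) mu0; rewrite flat_box// => /eqP.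
rewrite eqe gt_eqF// prodr_gt0// => i _.
rewrite lebesgue_measure_itv/= lte_fin ab/=.
by rewrite mulr_gt0 ?subr_gt0 ?normal_peak_gt0 ?gt_eqF.
Qed.

(** Two coordinates allow boxes of positive mass on which [sin2_at_gt0]
    applies. *)
Lemma mean_sin2_gt0 r : (1 < n)%N -> 0 < r -> (0 < mean_sin2 r)%E.
Proof.
move=> n1 r0; rewrite lt0e mean_sin2_ge0 andbT; apply/eqP => int0.
pose i : 'I_n := Ordinal (ltnW n1); pose j : 'I_n := Ordinal n1.
pose A := box (fun=> 0 : R) (fun _ : 'I_n => 1).
pose B := box (fun l : 'I_n => if l == j then -2 else 0 : R)
  (fun l : 'I_n => if l == j then - 1 else 1).
have pos z : (A `*` B) z -> 0 < sin2_at r (vec z.1) (vec z.2).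
  move=> [/= zA zB]; apply: (@sin2_at_gt0 _ _ r _ _ i j); rewrite mxE.
  - by have := zA i; rewrite in_itv/= => /andP[].
  - by have := zA j; rewrite in_itv/= => /andP[].
  - by have := zB i; rewrite in_itv/= => /andP[].
  - have := zB j; rewrite eqxx in_itv/= => /andP[_ h].
    by apply: (le_lt_trans h); rewrite oppr_lt0.
have mA : measurable A by exact: measurable_box.
have mB : measurable B by exact: measurable_box.
have : ((mu \x mu) (A `*` B) = 0)%E.
  have := @ae_eq_integral_abs _ _ _ (mu \x mu)%E setT measurableT _ (measurable_mean_sin2 r).
  case=> [h _]; case: h.
    rewrite -[RHS]int0; apply: eq_integral => z _.
    by rewrite gee0_abs// lee_fin sin2_at_ge0.
  move=> N [mN N0 subN]; apply: (subset_measure0 _ mN _ N0).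
    exact: measurableX.
  move=> z zAB; apply: subN => /= /(_ Logic.I) /eqP; rewrite eqe => /eqP h.
  by have := pos z zAB; rewrite h ltxx.
rewrite product_measure1E// => /eqP; rewrite mule_eq0 !gt_eqF//.
- by apply: box_gt0 => l; case: ifP => _; rewrite ?ltr01// ltrN2 ltr1n.
- by apply: box_gt0 => l.
Qed.

Section bounds.
Variables (r r' rb : R).
Hypotheses (r0 : 0 < r) (rr' : r < r') (rbin : r <= rb <= r').

Lemma shell_error_fin k : shell_error mu r r' k \is a fin_num.
Proof.
rewrite /shell_error fin_numD; apply/andP; split => //.
apply: fin_num_measure.
rewrite (_ : [set _ | _] = [set u | enorm (vec u) \in `]r - k, r + k[]).
  exact: measurable_enorm_itv.
by apply/seteqP; split => u /=; rewrite in_itv/= ltr_distl.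
Qed.

Lemma mean_cost_bound k : 0 < k -> 2 * (r' - r) <= k ->
  `|fine (mean_cost r r' rb) - fine (mean_gap2 r r' rb) * fine (mean_sin2 r)| <=
  2 * (fine (mean_gap2 r r' rb) * fine (shell_error mu r r' k)).
Proof.
move=> k0 ek; have [] := mean_cost_bound_ereal s0 muE r0 rr' rbin k0 ek.
have gfin := mean_gap2_fin mu rr' rbin; have sfin := mean_sin2_fin r.
have efin := shell_error_fin k.
rewrite -(fineK gfin) -(fineK sfin) -(fineK efin) -!EFinM -EFinD.
have Dfin : (2%:E * mean_cost r r' rb <= (2 * (fine (mean_gap2 r r' rb) * fine (mean_sin2 r)) +
   4 * (fine (mean_gap2 r r' rb) * fine (shell_error mu r r' k)))%:E)%E ->
  mean_cost r r' rb \is a fin_num.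
  move=> h; rewrite ge0_fin_numE ?mean_cost_ge0//.
  apply: (@le_lt_trans _ _ (2%:E * mean_cost r r' rb)%E); last first.
    by rewrite (le_lt_trans h)// ltry.
  by rewrite -[leLHS]mul1e lee_wpmul2r ?mean_cost_ge0// lee_fin ler1n.
move=> h1 h2; have D0 := Dfin h1.
rewrite -(fineK D0) -!EFinM -?EFinD !lee_fin in h1 h2.
by rewrite ler_norml; apply/andP; split; lra.
Qed.

End bounds.
End mean_values.

(** * From the random vectors to the law of U *)

Section iid.
Context (R : realType) d d' (T : measurableType d) (X : measurableType d')
  (P : probability T R).
Variables (A B A' B' : {RV P >-> X}).
Hypothesis iid : iid_copy P (fun w => (A w, B w)) (fun w => (A' w, B' w)).

Lemma iid_copy_ae (E : set (X * X)) : measurable E ->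
  {ae P, forall w, E (A w, B w)} -> {ae P, forall w, E (A' w, B' w)}.
Proof.
move=> mE; have mAB : measurable_fun setT (fun w => (A w, B w)).
  exact: measurable_fun_pair.
have mAB' : measurable_fun setT (fun w => (A' w, B' w)).
  exact: measurable_fun_pair.
have mC : measurable (~` E) by exact: measurableC.
move=> neg; apply/negligibleP.
  by rewrite -[X in measurable X]setTI; exact: (mAB' measurableT _ mC).
transitivity (P ((fun w => (A' w, B' w)) @^-1` (~` E))); first by [].
rewrite (iid.1 _ mC); apply: measure_negligible; last exact: neg.
by rewrite -[X in measurable X]setTI; exact: (mAB measurableT _ mC).
Qed.

(** A and A' have the same law, and the joint law of (A, A') agrees with the
    product law on rectangles. *)
Lemma iid_copy_integral (F : X * X -> \bar R) : measurable_fun setT F ->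
  (forall z, 0 <= F z)%E ->
  (\int[P]_w F (A w, A' w) =
   \int[distribution P A \x distribution P A]_z F z)%E.
Proof.
move=> mF F0.
have mAA : measurable_fun setT (fun w => (A w, A' w)) by exact: measurable_fun_pair.
suff prodE : forall C, measurable C ->
    (distribution P A \x distribution P A)%E C = image_measure P mAA C.
  rewrite -(ge0_integral_image P mAA)//.
  by apply: eq_measure_integral => C mC _; exact: (esym (prodE C mC)).
apply: product_measure_unique => D E mD mE.
have mDT : measurable (D `*` [set: X]) by exact: measurableX.
have mET : measurable (E `*` [set: X]) by exact: measurableX.
have := iid.2 _ _ mDT mET; rewrite (iid.1 _ mET).
have -> : (fun w => (A w, B w)) @^-1` (D `*` setT) `&`
    (fun w => (A' w, B' w)) @^-1` (E `*` setT) = (fun w => (A w, A' w)) @^-1` (D `*` E).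
  by apply/seteqP; split => w /=; [move=> [[? _] [? _]]|move=> [? ?]].
have pre G : (fun w => (A w, B w)) @^-1` (G `*` setT) = A @^-1` G.
  by apply/seteqP; split => w /=; [move=> []|].
by rewrite !pre.
Qed.

End iid.

Section transfer.
Context (R : realType) (n : nat) d (T : measurableType d) (P : probability T R).
Variables (U V : {RV P >-> n.-tuple R}) (r r' : R).
Hypotheses (r0 : 0 < r) (rr' : r < r').
Hypothesis P_shell : (0 < P (shell U r r'))%E.

Local Notation rb := (shell_radius U r r').
Local Notation mu := (distribution P U).

Lemma measurable_shell : measurable (shell U r r').
Proof.
have mS := measurable_enorm_itv (n := n) `[r, r'].
have mU : measurable_fun setT U by [].
rewrite (_ : shell U r r' = U @^-1` [set u | enorm (vec u) \in `[r, r']]).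
  by rewrite -[X in measurable X]setTI; exact: mU.
by apply/seteqP; split => w; rewrite /shell /= in_itv.
Qed.

(** A conditional second moment of |U| on the shell lies between r^2 and r'^2. *)
Lemma shell_radius_itv : r <= rb <= r'.
Proof.
have mS := measurable_shell.
have Pfin : P (shell U r r') \is a fin_num by exact: fin_num_measure.
have p0 : 0 < fine (P (shell U r r')) by rewrite fine_gt0// P_shell/= -ge0_fin_numE.
have r'0 := lt_trans r0 rr'.
have mf : measurable_fun setT (fun w => enorm (vec (U w)) ^+ 2).
  by apply: measurable_funX; apply: measurable_enorm; exact: measurable_vec.
have mfi : measurable_fun setT (fun w => (enorm (vec (U w)) ^+ 2 * \1_(shell U r r') w)%:E).
  by apply/measurable_EFinP; apply: measurable_funM => //; exact: measurable_indic.
have cstI (c : R) : 0 <= c ->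
    (\int[P]_w (c * \1_(shell U r r') w)%:E = (c * fine (P (shell U r r')))%:E)%E.
  move=> c0; under eq_integral do rewrite EFinM.
  rewrite ge0_integralZl//; last by apply/measurable_EFinP; exact: measurable_indic.
  by rewrite integral_indic// setIT EFinM fineK.
pose X0 (w : T) := enorm (vec (U w)) ^+ 2 * \1_(shell U r r') w.
have lo : ((r ^+ 2 * fine (P (shell U r r')))%:E <=
    'E_P[X0])%E.
  rewrite unlock -cstI ?sqr_ge0//; apply: ge0_le_integral => //.
  - by move=> w _; rewrite lee_fin mulr_ge0// sqr_ge0.
  - by apply/measurable_EFinP; apply: measurable_funM => //; exact: measurable_indic.
  - move=> w _; rewrite lee_fin /X0 indicE; case: (boolP (w \in _)) => [/set_mem|_].
      rewrite /shell/= => /andP[h _]; rewrite !mulr1 ler_sqr ?nnegrE ?enorm_ge0//.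
      exact: ltW.
    by rewrite !mulr0.
have hi : ('E_P[X0] <=
    (r' ^+ 2 * fine (P (shell U r r')))%:E)%E.
  rewrite unlock -cstI ?sqr_ge0//; apply: ge0_le_integral => //.
  - by move=> w _; rewrite lee_fin mulr_ge0// sqr_ge0.
  - by apply/measurable_EFinP; apply: measurable_funM => //; exact: measurable_indic.
  - move=> w _; rewrite lee_fin /X0 indicE; case: (boolP (w \in _)) => [/set_mem|_].
      rewrite /shell/= => /andP[_ h]; rewrite !mulr1 ler_sqr ?nnegrE ?enorm_ge0//.
      exact: ltW.
    by rewrite !mulr0.
have Efin : 'E_P[X0]%E \is a fin_num.
  rewrite ge0_fin_numE; first by rewrite (le_lt_trans hi)// ltry.
  by apply: expectation_ge0 => w; rewrite mulr_ge0// sqr_ge0.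
rewrite -(fineK Efin) !lee_fin in lo hi.
rewrite /shell_radius /cond_expectation.
rewrite -/X0; set q := _ / _.
have q1 : r ^+ 2 <= q by rewrite ler_pdivlMr.
have q2 : q <= r' ^+ 2 by rewrite ler_pdivrMr.
have := ler_wsqrtr q1; have := ler_wsqrtr q2.
by rewrite !sqrtr_sqr !gtr0_norm// => -> ->.
Qed.

Hypothesis hV : shell_collapse U V r r'.

(** Recovers V from its norm and its direction. *)
Lemma shell_collapse_ae :
  {ae P, forall w, vec (V w) = collapse r r' rb (vec (U w))}.
Proof.
case: hV => h1 h2; apply: filterS2 h1 h2 => w h1 h2.
rewrite -[LHS]unitdirK /unitdir h1 h2 /collapse -/(unitdir _); congr (_ *: _).
rewrite !indicE; case: (boolP (in_shell r r' (vec (U w)))) => h.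
  have wS : w \in shell U r r' by apply/mem_set.
  by rewrite in_setC wS mulr0 add0r mulr1.
have wS : (w \in shell U r r') = false by apply/negbTE/negP => /set_mem; exact/negP.
by rewrite in_setC wS mulr0 addr0 mulr1.
Qed.

Lemma expectation_sqr_dist :
  'E_P[fun w => (enorm (vec (V w) - vec (U w)) ^+ 2)%R]%E = mean_gap2 mu r r' rb.
Proof.
have mU : measurable_fun setT U by [].
have mvU : measurable_vector (fun w => vec (U w)) by exact: measurable_vec.
have mvV : measurable_vector (fun w => vec (V w)) by exact: measurable_vec.
rewrite unlock.
rewrite (ae_eq_integral (fun w => (radial_gap r r' rb (vec (U w)) ^+ 2)%:E))//; last 3 first.
- apply/measurable_EFinP; apply: measurable_funX.
  by apply: measurable_enorm; exact: measurable_vectorB.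
- by apply/measurable_EFinP; apply: measurable_funX; exact: measurable_radial_gap.
- apply: filterS shell_collapse_ae => w -> _.
  by rewrite sqr_enorm_collapseB.
rewrite /mean_gap2 ge0_integral_distribution//.
- apply/measurable_EFinP; apply: measurable_funX; apply: measurable_radial_gap.
  exact: measurable_vec.
- by move=> y; rewrite lee_fin sqr_ge0.
Qed.

Lemma measurable_collapse_graph :
  measurable [set z : n.-tuple R * n.-tuple R | vec z.2 = collapse r r' rb (vec z.1)].
Proof.
have m1 : measurable_vector (fun z : n.-tuple R * n.-tuple R => vec z.1).
  exact: measurable_vec.
have m2 : measurable_vector (fun z : n.-tuple R * n.-tuple R => vec z.2).
  exact: measurable_vec.
have mc := measurable_collapse r r' rb m1.
rewrite (_ : [set _ | _] = \bigcap_(i in [set: 'I_n])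
    [set z | vec z.2 ord0 i = collapse r r' rb (vec z.1) ord0 i]).
  apply: fin_bigcap_measurable => // i _.
  have := measurable_fun_eqr (m2 i) (mc i) measurableT (Y := [set true]) I.
  rewrite setTI; congr measurable; apply/seteqP; split => z /=; by move/eqP.
apply/seteqP; split => z /= => [h i _|h]; first by rewrite /= h.
by apply/rowP => i; exact: h.
Qed.

(** The graph of [collapse] has full measure for the law of (U, V), which is
    also the law of (Us, Vs): so Vs too is the collapse of Us almost surely. *)
Lemma expectation_pair_cost (Us Vs : {RV P >-> n.-tuple R}) :
  iid_copy P (fun w => (U w, V w)) (fun w => (Us w, Vs w)) ->
  'E_P[fun w => (enorm (vec (U w) - vec (Us w)) * enorm (vec (V w) - vec (Vs w)) -
     dotp (vec (U w) - vec (Us w)) (vec (V w) - vec (Vs w)))%R]%E =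
  mean_cost mu r r' rb.
Proof.
move=> iid.
have mv (A : {RV P >-> n.-tuple R}) : measurable_vector (fun w => vec (A w)).
  exact: measurable_vec.
have VsE := iid_copy_ae iid measurable_collapse_graph shell_collapse_ae.
rewrite unlock.
rewrite (ae_eq_integral
  (fun w => (pair_cost r r' rb (vec (U w)) (vec (Us w)))%:E))//; last 3 first.
- apply/measurable_EFinP; apply: measurable_excess; exact: measurable_vectorB.
- by apply/measurable_EFinP; exact: measurable_pair_cost.
- by apply: filterS2 shell_collapse_ae VsE => w /= -> -> _.
apply: (iid_copy_integral iid (F := fun z => (pair_cost r r' rb (vec z.1) (vec z.2))%:E)).
- apply/measurable_EFinP; apply: measurable_pair_cost; exact: measurable_vec.
- by move=> z; rewrite lee_fin pair_cost_ge0.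
Qed.

End transfer.

(** * The inner and the outer limit *)

(** With g the mean squared gap and D the mean cost, the ratio is
    (1 - g/4) / (D/g).  Here g tends to 0, and D/g tends to the mean squared
    sine: in [mean_cost_bound], k is chosen first, to make the mass near the
    sphere small, and then r' close to r. *)
Lemma mean_cost_ratio_cvg (R : realType) (s : R) (n : nat) (s0 : 0 < s) (n1 : (1 < n)%N)
    (mu : probability (n.-tuple R) R)
    (muE : forall B : 'I_n -> set R, (forall i, measurable (B i)) ->
      mu [set u | forall i, B i (tnth u i)] = (\prod_(i < n) normal_prob 0 s (B i))%E)
    (r : R) (rb : R -> R) : 0 < r -> (forall r', r < r' -> r <= rb r' <= r') ->
  f (fine (mean_gap2 mu r r' (rb r'))) / fine (mean_cost mu r r' (rb r'))
    @[r' --> r^'+] --> (fine (mean_sin2 mu r))^-1.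
Proof.
move=> r0 rbP; set S := fine (mean_sin2 mu r).
have Sp : 0 < S.
  rewrite /S fine_gt0// (mean_sin2_gt0 s0 muE)//=.
  by rewrite -ge0_fin_numE ?mean_sin2_fin// mean_sin2_ge0.
pose g r' := fine (mean_gap2 mu r r' (rb r')).
pose D r' := fine (mean_cost mu r r' (rb r')).
have gp r' : r < r' -> 0 < g r'.
  move=> rr'; rewrite /g fine_gt0// (mean_gap2_gt0 s0 muE _ r0 rr' (ltnW n1))/=.
  by rewrite -ge0_fin_numE ?mean_gap2_ge0// (mean_gap2_fin _ rr' (rbP _ rr')).
have gle r' : r < r' -> g r' <= (r' - r) ^+ 2.
  move=> rr'; rewrite -lee_fin fineK ?(mean_gap2_fin _ rr' (rbP _ rr'))//.
  exact: (mean_gap2_le _ rr' (rbP _ rr')).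
have g_cvg : g r' @[r' --> r^'+] --> 0.
  apply/cvgrPdist_le => e e0; near=> r'.
  have rr' : r < r' by near: r'; exact: nbhs_right_gt.
  have h1 : r' - r < e by near: r'; exact: nbhs_right_ltDr.
  have h2 : r' - r < 1 by near: r'; exact: nbhs_right_ltDr.
  rewrite sub0r normrN (gtr0_norm (gp _ rr')) (le_trans (gle _ rr'))//.
  apply: (le_trans _ (ltW h1)).
  by rewrite expr2 ler_piMr ?subr_ge0 ?ltW.
have q_cvg : D r' / g r' @[r' --> r^'+] --> S.
  apply/cvgrPdist_le => e e0; have e40 : 0 < e / 4 by rewrite divr_gt0.
  have [k k0 Hk] := near_sphere_small s0 muE r0 e40.
  have ek0 : 0 < e / 16 * k by rewrite mulr_gt0// divr_gt0.
  have k20 : 0 < k / 2 by rewrite divr_gt0.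
  near=> r'.
  have rr' : r < r' by near: r'; exact: nbhs_right_gt.
  have h1 : r' - r < e / 16 * k by near: r'; exact: nbhs_right_ltDr.
  have h2 : r' - r < k / 2 by near: r'; exact: nbhs_right_ltDr.
  have h3 : 2 * (r' - r) <= k by lra.
  have := mean_cost_bound s0 muE r0 rr' (rbP _ rr') k0 h3.
  rewrite -/(g r') -/(D r') -/S => h4.
  have -> : S - D r' / g r' = - ((D r' - g r' * S) / g r').
    by rewrite mulrBl -[g r' * S]mulrC mulfK ?gt_eqF ?gp// opprB.
  rewrite normrN normrM normfV (gtr0_norm (gp _ rr')) ler_pdivrMr ?gp//.
  apply: (le_trans h4); rewrite mulrCA mulrC ler_wpM2r ?(ltW (gp _ rr'))//.
  have h5 : fine (shell_error mu r r' k) <= e / 2.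
    rewrite -lee_fin fineK ?shell_error_fin// /shell_error.
    rewrite (_ : e / 2 = e / 4 + e / 4); last by field.
    rewrite EFinD leeD// lee_fin ler_pdivrMr//; lra.
  lra.
have : (1 - g r' / 4) / (D r' / g r') @[r' --> r^'+] --> (1 - 0 / 4) / S.
  apply: cvgM.
    by apply: cvgB; [exact: cvg_cst|apply: cvgM => //; exact: cvg_cst].
  by apply: cvgV => //; rewrite gt_eqF.
rewrite mul0r subr0 mul1r; apply: cvg_trans; apply: near_eq_cvg.
near=> r'.
rewrite -/(g r') -/(D r') /f invf_div mulrA; congr (_ / _).
by rewrite mulrBl mul1r expr2 mulrAC.
Unshelve. all: by end_near. Qed.

Theorem lemma2p12 (R : realType) (d : nat) (hd : (2 <= d)%N)
    (disp : measure_display) (T : measurableType disp) (P : probability T R)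
    (U : {RV P >-> d.-tuple R}) (V Us Vs : R -> R -> {RV P >-> d.-tuple R})
    (hU : isotropic_gaussian (Num.sqrt (d%:R^-1)) U)
    (hV : forall rm rp : R, 0 < rm -> rm < rp ->
       shell_collapse U (V rm rp) rm rp)
    (hUVs : forall rm rp : R, 0 < rm -> rm < rp ->
       iid_copy P (fun w => (U w, V rm rp w))
                  (fun w => (Us rm rp w, Vs rm rp w))) :
  exists L : R -> \bar R,
    (forall rm : R, 0 < rm ->
       (cost_ratio U (V rm rp) (Us rm rp) (Vs rm rp))%:E @[rp --> rm^'+] --> L rm) /\
    L rm @[rm --> +oo] --> +oo%E.
Proof.
have d0 : (0 < d)%N := ltnW hd.
have s0 : 0 < Num.sqrt (d%:R^-1) :> R by rewrite sqrtr_gt0 invr_gt0 ltr0n.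
pose mu : probability (d.-tuple R) R := distribution P U.
have muE : forall B : 'I_d -> set R, (forall i, measurable (B i)) ->
    mu [set u | forall i, B i (tnth u i)] =
    (\prod_(i < d) normal_prob 0 (Num.sqrt (d%:R^-1)) (B i))%E by exact: hU.
have mean_gt0 rm : 0 < rm -> 0 < fine (mean_sin2 mu rm).
  move=> rm0; rewrite fine_gt0// (mean_sin2_gt0 s0 muE)//=.
  by rewrite -ge0_fin_numE ?mean_sin2_fin// mean_sin2_ge0.
exists (fun rm => ((fine (mean_sin2 mu rm))^-1)%:E); split.
  move=> rm rm0.
  have P_shell rp : rm < rp -> (0 < P (shell U rm rp))%E.
    move=> rmp; rewrite (_ : shell U rm rp = U @^-1` [set u | enorm (vec u) \in `[rm, rp]]).
      exact: (shell_gt0 s0 muE d0 rm0 rmp).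
    by apply/seteqP; split => w; rewrite /shell/= in_itv.
  have rbP rp : rm < rp -> rm <= shell_radius U rm rp <= rp.
    by move=> rmp; exact: (shell_radius_itv rm0 rmp (P_shell _ rmp)).
  have cvg := mean_cost_ratio_cvg s0 hd muE rm0 rbP.
  apply: cvg_EFin; first by near=> rp.
  apply: cvg_trans cvg; apply: near_eq_cvg; near=> rp.
  have rmp : rm < rp by near: rp; exact: nbhs_right_gt.
  rewrite /= /cost_ratio (expectation_sqr_dist rm0 (hV _ _ rm0 rmp)).
  by rewrite (expectation_pair_cost (hV _ _ rm0 rmp) (hUVs _ _ rm0 rmp)).
apply/cvgeyPge => A.
pose A' := Num.max A 1; have A'0 : 0 < A' by rewrite lt_max ltr01 orbT.
have A'i : 0 < A'^-1 by rewrite invr_gt0.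
have [r1 Hr1] := mean_sin2_small muE A'i.
near=> rm.
have rm0 : 0 < rm by near: rm; exact: nbhs_pinfty_gt.
have rm1 : r1 < rm by near: rm; apply: nbhs_pinfty_gt; exact: num_real.
have := Hr1 _ rm1.
rewrite lee_fin -[X in (X <= _)%E](fineK (mean_sin2_fin mu rm)) lee_fin => h.
apply: (@le_trans _ _ A'); first by rewrite le_max lexx.
by rewrite -[A']invrK lef_pV2 ?posrE ?invr_gt0 ?mean_gt0.
Unshelve. all: by end_near. Qed.
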